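(* Let $\mathbf D=\mathbf D(k,\pi_\bullet)$ be a generalized divided power algebra over a commutative ring $k$. Then $\mathbf D^{[h]}$ is graded-coherent for all $h\ge 1$ if and only if the following three conditions hold: (A1) $k$ is a coherent ring; (A2) for every finitely generated ideal $\mathfrak a$ of $k$ and every $h\ge1$, there exists $n\ge 1$ such that $a(n;\pi^{[h]}_\bullet)$ annihilates $T^{[h]}(k/\mathfrak a)$; (A3) for every $h\ge 1$ and every strictly ascending chain $\mathfrak a_1\subsetneq\mathfrak a_2\subsetneq\cdots$ of finitely generated $\pi^{[h]}$-ideals, there is some $i$ for which $\mathbf D^{[h]}/\mathfrak a_i\mathbf D^{[h]}$ is graded-coherent.
   Context: All rings are commutative with $1$. $\pi$-sequences. Let $k$ be a commutative ring. A $\pi$-sequence in $k$ is a sequence $\pi_\bullet=(\pi_n)_{n\ge 2}$ of elements of $k$; by convention $\pi_1=0$. For integers $j\ge 1$ and $n,m\ge 0$ put $\epsilon_j(n,m)=\lfloor (n+m)/j\rfloor-\lfloor n/j\rfloor-\lfloor m/j\rfloor\in\{0,1\}$. For $0\le m\le n$ put $C(n,m)=\prod_{j\ge 2}\pi_j^{\epsilon_j(n-m,m)}$. The sequence $\pi_\bullet$ is admissible if, whenever $(\pi_n,\pi_m)$ is not the unit ideal of $k$, either $n\mid m$ or $m\mid n$. GDPAs. $\mathbf D(k,\pi_\bullet)$ is the graded $k$-algebra that is free as a $k$-module on the basis $x^{[i]}$ ($i\ge0$), with $\deg x^{[i]}=i$ and multiplication $x^{[n-m]}x^{[m]}=C(n,m)\,x^{[n]}$.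 A generalized divided power algebra (GDPA) is a graded $k$-algebra isomorphic to $\mathbf D(k,\pi_\bullet)$ with $\pi_\bullet$ admissible. Further notation. - For $n\ge 1$ put $a(n;\pi_\bullet)=\prod_{d\mid n,\ d\ne 1}\pi_d$. - For $h\ge1$, the $h$-transform of $\pi_\bullet$ is the $\pi$-sequence $\pi^{[h]}_\bullet$ given by $\pi^{[h]}_n=\prod_{d\mid h,\ \gcd(h/d,n)=1}\pi_{dn}$ for $n\ge 2$. - $\mathbf D^{[h]}=\mathbf D(k,\pi^{[h]}_\bullet)$. - For a $k$-module $M$, $T^{[h]}(M)$ is the submodule of elements of $M$ annihilated by $a(n;\pi^{[h]}_\bullet)$ for some $n\ge 1$. - A $\pi^{[h]}$-ideal is an ideal of $k$ generated by some subset of the elements $\pi^{[h]}_n$. - A graded ring is graded-coherent if every finitely generated homogeneous ideal is finitely presented. *)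

(* Defs.v *)
From HB Require Import structures.
From mathcomp Require Import all_boot all_order all_algebra.
Set Implicit Arguments. Unset Strict Implicit. Unset Printing Implicit Defensive.
Import GRing.Theory.
Local Open Scope ring_scope.

(* Generic finiteness notions for ideals of a quotient ring R/J, where *)
(* R is given by its additive group and a multiplication [mul], and    *)
(* J : R -> Prop is an ideal of R.  An ideal of R/J is represented by  *)
(* its preimage I in R (a predicate containing J).  Taking J = (= 0)   *)
(* gives the usual notions for R itself.                               *)
Section Generic.
Variables (R : zmodType) (mul : R -> R -> R) (J : R -> Prop).

Definition lcomb (c s : seq R) : R := \sum_(i < size s) mul c`_i s`_i.

Definition gen_mod (s : seq R) : R -> Prop :=
  fun x => exists c : seq R, J (x - lcomb c s).

Definition fg_mod (I : R -> Prop) : Prop :=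
  exists s : seq R, forall x, I x <-> gen_mod s x.

Definition syz_mod (s c : seq R) : Prop :=
  size c = size s /\ J (lcomb c s).

Definition fg_syz_mod (s : seq R) : Prop :=
  exists rs : seq (seq R),
    (forall j, (j < size rs)%N -> syz_mod s (nth [::] rs j)) /\
    (forall c, syz_mod s c ->
       exists d : seq R, forall i, (i < size s)%N ->
         J (c`_i - \sum_(j < size rs) mul d`_j (nth [::] rs j)`_i)).

Definition fp_mod (I : R -> Prop) : Prop :=
  exists s : seq R, (forall x, I x <-> gen_mod s x) /\ fg_syz_mod s.

Definition coherent_mod : Prop :=
  forall I : R -> Prop, fg_mod I -> fp_mod I.

Definition homogeneous_mod (comp : nat -> R -> R) (I : R -> Prop) : Prop :=
  forall x, I x -> forall d, I (comp d x).

Definition graded_coherent_mod (comp : nat -> R -> R) : Prop :=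
  forall I : R -> Prop, homogeneous_mod comp I -> fg_mod I -> fp_mod I.

End Generic.

Section RingIdeals.
Variable k : comNzRingType.

Definition kzero : k -> Prop := fun x => x = 0.

Definition kgen (s : seq k) : k -> Prop := gen_mod ( *%R) kzero s.

Definition kfg (I : k -> Prop) : Prop := fg_mod ( *%R) kzero I.

Definition kgen_set (P : k -> Prop) : k -> Prop :=
  fun x => exists s : seq k, (forall i, (i < size s)%N -> P s`_i) /\ kgen s x.

Definition coherent_ring : Prop := coherent_mod ( *%R) kzero.
End RingIdeals.

Section GDPA.
Variable k : comNzRingType.
Implicit Types pi : nat -> k.

(* value pi_n, with the convention pi_1 = 0 (pi_0 is never used) *)
Definition pv pi (n : nat) : k := if (2 <= n)%N then pi n else 0.

Definition eps (j n m : nat) : nat := ((n + m) %/ j - n %/ j - m %/ j)%N.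

(* C(n,m) = prod_{j>=2} pi_j^{eps_j(n-m,m)}; factors with j > n are 1 *)
Definition Ccoef pi (n m : nat) : k :=
  \prod_(2 <= j < n.+1) pv pi j ^+ eps j (n - m) m.

(* D(k,pi) is modelled on {poly k}: the coefficient of 'X^i is the
   coordinate on x^[i].  Multiplication: x^[n-m] x^[m] = C(n,m) x^[n]. *)
Definition dmul pi (p q : {poly k}) : {poly k} :=
  \poly_(n < (size p + size q).-1)
     \sum_(m < n.+1) p`_(n - m) * q`_m * Ccoef pi n m.

Definition dcomp (d : nat) (p : {poly k}) : {poly k} := (p`_d)%:P * 'X^d.

Definition ext_ideal pi (A : k -> Prop) : {poly k} -> Prop :=
  fun p => exists s : seq k, (forall i, (i < size s)%N -> A s`_i) /\
    gen_mod (dmul pi) (fun q => q = 0) (map polyC s) p.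

Definition D_graded_coherent pi (J : {poly k} -> Prop) : Prop :=
  graded_coherent_mod (dmul pi) J dcomp.

Definition admissible pi : Prop :=
  forall n m : nat, (1 <= n)%N -> (1 <= m)%N ->
    ~ (exists u v : k, u * pv pi n + v * pv pi m = 1) ->
    (n %| m)%N \/ (m %| n)%N.

Definition a_fun pi (n : nat) : k :=
  \prod_(d <- divisors n | d != 1%N) pv pi d.

Definition htrans pi (h : nat) : nat -> k :=
  fun n => \prod_(d <- divisors h | coprime (h %/ d) n) pv pi (d * n).

Definition pi_ideal pi (h : nat) (I : k -> Prop) : Prop :=
  exists S : nat -> Prop, (forall n, S n -> (2 <= n)%N) /\
    forall x, I x <-> kgen_set (fun y => exists n, S n /\ y = pv (htrans pi h) n) x.

Definition condA2 pi : Prop :=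
  forall (A : k -> Prop) (h : nat), kfg A -> (1 <= h)%N ->
    exists n : nat, (1 <= n)%N /\
      forall x : k,
        (* the class of x in k/A lies in T^[h](k/A) *)
        (exists m : nat, (1 <= m)%N /\ A (a_fun (htrans pi h) m * x)) ->
        A (a_fun (htrans pi h) n * x).

Definition condA3 pi : Prop :=
  forall (h : nat) (A : nat -> k -> Prop), (1 <= h)%N ->
    (forall i, kfg (A i) /\ pi_ideal pi h (A i)) ->
    (forall i, (forall x, A i x -> A i.+1 x) /\ (exists x, A i.+1 x /\ ~ A i x)) ->
    exists i, D_graded_coherent (htrans pi h) (ext_ideal (htrans pi h) (A i)).

End GDPA.

(* Main.v *)
Require Import Defs.
From HB Require Import structures.
From mathcomp Require Import all_boot all_order all_algebra.
From mathcomp Require Import zify ring.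
From Stdlib Require Import Classical.
Set Implicit Arguments. Unset Strict Implicit. Unset Printing Implicit Defensive.
Import GRing.Theory.
Local Open Scope ring_scope.

(* Only A1 and A2 are needed for coherence.  Let [J] be generated by
   [c_i x^[n_i]] with [n_i <= d]; in degree [n] the relations are the vectors [b]
   with [sum_i b_i C(n, n_i) c_i = 0], and [k] being coherent it is enough to
   bound the degrees in which relations have to be taken.  This can be checked
   locally, and by admissibility the nonunits among the [pi_j] then form a chain
   under divisibility.  Let [j0] be the largest of them that is at most
   [2 d + 1] (or [1]).  Only larger chain elements [j] can tell [n] from smaller
   degrees congruent to it modulo [j0], and they do so only if
   [n mod j = rho < d], where [rho] does not depend on [j].  Then, up to units,
   [C(n, n_i)] is a factor depending on [n mod j0], times, when [rho < n_i], the
   product [A (n - rho)] of the [pi_j] with [j | n - rho] large.  Hence the part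
   of a relation supported on [rho < n_i] gives a torsion element of [k / J_rho]
   for the [j0]-transform; by A2 it is killed by [A (j0 N)] with [N] fixed, so it
   already occurs in degree [rho + e] with [e | j0 N].  What remains of the
   relation comes from degree [rho]. *)

(** * Carries and structure constants *)

Lemma epsC j n m : eps j n m = eps j m n.
Proof. by rewrite /eps addnC -!subnDA [(n %/ j + _)%N]addnC. Qed.

Lemma leq_divD_sub j n m : (n %/ j + m %/ j <= (n + m) %/ j)%N.
Proof. by case: j => [|j]; rewrite ?divn0 // divnD // leq_addr. Qed.

(** Either side is the excess of the floor of [(a + b + c) / j] over the sum of the three separate
    floors. This is what makes [dmul] associative. *)
Lemma eps_cocycle j a b c :
  (eps j a b + eps j (a + b) c = eps j a (b + c) + eps j b c)%N.
Proof.
rewrite /eps addnA.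
have := leq_divD_sub j a b; have := leq_divD_sub j (a + b) c.
have := leq_divD_sub j a (b + c); have := leq_divD_sub j b c.
rewrite addnA.
move: (a %/ j)%N (b %/ j)%N (c %/ j)%N ((a + b) %/ j)%N ((b + c) %/ j)%N.
by move: ((a + b + c) %/ j)%N => *; lia.
Qed.

Lemma eps0r j n : eps j n 0 = 0%N.
Proof. by rewrite /eps addn0 div0n subnn. Qed.

Lemma eps_small j n m : (n + m < j)%N -> eps j n m = 0%N.
Proof. by move=> lt_j; rewrite /eps divn_small. Qed.

Lemma eps_dvd j n m : (j %| n)%N -> eps j n m = 0%N.
Proof. by move=> dv; rewrite /eps divnDl // addKn subnn. Qed.

(** Adding [n - a] and [a] in base [j] carries out of the units digit exactly when the resulting
    digit is smaller than that of [a]. So [n] matters only through its residue. *)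
Lemma eps_carry j n a : (0 < j)%N -> (a <= n)%N ->
  eps j (n - a) a = (n %% j < a %% j)%N.
Proof.
move=> j0 le_an; rewrite /eps subnK // divnB //.
have := leq_div2r j le_an; case: ltnP => [lt_mod | _]; last by rewrite subn0; case: (_ %/ _)%N => *; lia.
move=> le_q; suff : (a %/ j < n %/ j)%N.
  by move: (n %/ j)%N (a %/ j)%N => *; lia.
rewrite ltn_neqAle le_q andbT; apply/eqP => eq_q; move: le_an.
by rewrite (divn_eq n j) (divn_eq a j) eq_q leq_add2l leqNgt lt_mod.
Qed.

(** Division by [j = u * e] is division by [e] and then by [u], and adding [y < e] to a multiple of
    [e] does not change the first quotient. *)
Lemma eps_nocarry j e x y : (e %| x)%N -> (y < e)%N -> (e %| j)%N ->
  eps j x y = 0%N.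
Proof.
move=> /dvdnP[q ->] lt_ye /dvdnP[u ->].
have e0 : (0 < e)%N by apply: leq_trans lt_ye.
rewrite /eps ![(u * e)%N]mulnC !divnMA.
by rewrite divnMDl // mulnK // (divn_small lt_ye) div0n addn0 subn0 subnn.
Qed.

Section Coefficients.
Variable k : comNzRingType.
Implicit Types pi : nat -> k.

(** Factors beyond [n] have exponent 0; over a common range, products of structure constants can be
    compared index by index. *)
Lemma Ccoef_widen pi n m b : (m <= n)%N -> (n <= b)%N ->
  Ccoef pi n m = \prod_(2 <= j < b.+1) pv pi j ^+ eps j (n - m) m.
Proof.
move=> le_mn le_nb; rewrite /Ccoef.
case: (leqP 1 n) => [n1|]; last first.
  rewrite ltnS leqn0 => /eqP n0; move: le_mn; rewrite n0 leqn0 => /eqP ->.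
  by rewrite !big1 // => i _; rewrite eps0r.
rewrite [RHS](@big_cat_nat _ _ _ n.+1) //=.
rewrite [X in _ = _ * X]big1_seq ?mulr1 // => j.
rewrite mem_index_iota => /and3P[_ lt_nj _].
by rewrite eps_small // subnK.
Qed.

Lemma Ccoef0 pi n : Ccoef pi n 0 = 1.
Proof. by rewrite /Ccoef big1 // => j _; rewrite eps0r. Qed.

Lemma Ccoef_id pi n : Ccoef pi n n = 1.
Proof.
by rewrite /Ccoef big1 // => j _; rewrite subnn epsC eps0r.
Qed.

Lemma Ccoef_sym pi a b : Ccoef pi (a + b) b = Ccoef pi (b + a) a.
Proof.
rewrite /Ccoef addnC; apply: eq_bigr => j _.
by rewrite addnK addKn epsC.
Qed.

Lemma Ccoef_cocycle pi a b c :
  Ccoef pi (a + b) b * Ccoef pi (a + b + c) c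
  = Ccoef pi (a + b + c) (b + c) * Ccoef pi (b + c) c.
Proof.
rewrite !(@Ccoef_widen pi _ _ (a + b + c)) ?leq_addl ?leq_addr //;
  try by rewrite -?addnA ?leq_addl.
rewrite -!big_split /=; apply: eq_bigr => j _.
rewrite !addnK -[(a + b + c)%N in RHS]addnA addnK -!exprD.
by congr (_ ^+ _); rewrite eps_cocycle.
Qed.

Lemma Ccoef_split pi1 pi2 pi n m :
  (forall j, pv pi j = pv pi1 j * pv pi2 j) ->
  Ccoef pi n m = Ccoef pi1 n m * Ccoef pi2 n m.
Proof.
move=> E; rewrite /Ccoef -big_split /=.
by apply: eq_bigr => j _; rewrite E exprMn.
Qed.

(** Adding 1 to [n - 1] carries in base [j] exactly when [j] divides [n]. Thus [x^[n-1] x^[1] = a(n)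
    x^[n]], which is how the torsion of (A2) enters the relations of [D]. *)
Lemma Ccoef1 pi n : (0 < n)%N -> Ccoef pi n 1 = a_fun pi n.
Proof.
move=> n0; rewrite /Ccoef /a_fun.
rewrite (eq_big_seq (fun j => if (j %| n)%N then pv pi j else 1)); last first.
  move=> j; rewrite mem_index_iota => /andP[j2 _].
  rewrite eps_carry ?(modn_small j2) //; last by apply: leq_trans j2.
  by rewrite ltnS leqn0 -/(dvdn j n); case: (j %| n)%N; rewrite ?expr1.
rewrite -big_mkcond -[LHS]big_filter -[RHS]big_filter; apply: perm_big.
apply: uniq_perm; rewrite ?filter_uniq ?iota_uniq ?divisors_uniq //.
move=> j; rewrite !mem_filter mem_index_iota -dvdn_divisors //.
case dv: (j %| n)%N; rewrite ?andbF //= andbT.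
have := dvdn_leq n0 dv; have := dvdn_gt0 n0 dv; lia.
Qed.

End Coefficients.

(** * The ring D(k, pi) *)

(* An alias, so that [dmul pi] does not compete with the product of polynomials. *)
Definition gdpa (k : comNzRingType) (pi : nat -> k) : Type := {poly k}.

Section Ring.
Variable k : comNzRingType.
Variable pi : nat -> k.
Local Notation gdpa := (gdpa pi).

HB.instance Definition _ := GRing.Zmodule.on gdpa.

Definition dcoef (p : gdpa) (n : nat) : k := (p : {poly k})`_n.
Definition dmon (c : k) (n : nat) : gdpa := c%:P * 'X^n.

Lemma dcoef_mon c m n : dcoef (dmon c m) n = c *+ (n == m).
Proof. by rewrite /dcoef /dmon coefCM coefXn mulr_natr. Qed.

Lemma dcoefP (p q : gdpa) : (forall n, dcoef p n = dcoef q n) -> p = q.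
Proof. by move=> E; apply/polyP. Qed.

Lemma dcoefD (p q : gdpa) n : dcoef (p + q) n = dcoef p n + dcoef q n.
Proof. exact: coefD. Qed.

Lemma dcoef0 n : dcoef 0 n = 0.
Proof. exact: coef0. Qed.

Lemma dcoef_sum (I : Type) (r : seq I) (F : I -> gdpa) n :
  dcoef (\sum_(i <- r) F i) n = \sum_(i <- r) dcoef (F i) n.
Proof. exact: coef_sum. Qed.

Lemma dcoef_small (p : gdpa) n : (size (p : {poly k}) <= n)%N -> dcoef p n = 0.
Proof. exact: nth_default. Qed.

Lemma dmon_sum (p : gdpa) b : (size (p : {poly k}) <= b)%N ->
  p = \sum_(n <- iota 0 b) dmon (dcoef p n) n.
Proof.
move=> le_b; apply: dcoefP => n; rewrite dcoef_sum.
rewrite (eq_bigr (fun m => if m == n then dcoef p n else 0)); last first.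
  by move=> m _; rewrite dcoef_mon eq_sym; case: eqP => [->|_].
rewrite -big_mkcond -big_filter (perm_big (if (n < b)%N then [:: n] else [::])).
  case: ltnP => [_|le_n]; rewrite ?big_seq1 // big_nil.
  by rewrite dcoef_small //; apply: leq_trans le_n.
apply: uniq_perm; rewrite ?filter_uniq ?iota_uniq //; first by case: ifP.
move=> m; rewrite mem_filter mem_iota /=.
case: (eqVneq m n) => [->|ne] /=; first by case: ltnP; rewrite ?inE ?eqxx.
by case: ltnP; rewrite ?inE ?(negPf ne).
Qed.

Lemma dmon_ind (P : gdpa -> Prop) :
  P 0 -> (forall p q, P p -> P q -> P (p + q)) -> (forall c n, P (dmon c n)) ->
  forall p, P p.
Proof.
move=> P0 PD Pm p; rewrite (dmon_sum (leqnn (size (p : {poly k})))).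
by apply: big_ind.
Qed.

Lemma dcoefM (p q : gdpa) n :
  dcoef (dmul pi p q) n
  = \sum_(m < n.+1) dcoef p (n - m) * dcoef q m * Ccoef pi n m.
Proof.
rewrite /dcoef coef_poly; case: ltnP => // le_n; apply/esym/big1 => m _.
case: (leqP (size (p : {poly k})) (n - m)) => [le_p|lt_p].
  by rewrite (nth_default 0 le_p) !mul0r.
rewrite [q`_m]nth_default ?mulr0 ?mul0r //.
move: le_n lt_p (ltn_ord m); move: (size (p : {poly k})) (size (q : {poly k})) => *.
lia.
Qed.

Lemma dmulC : commutative (dmul pi).
Proof.
move=> p q; apply: dcoefP => n; rewrite !dcoefM.
rewrite (reindex_inj rev_ord_inj); apply: eq_bigr => m _ /=.
have le_mn : (m <= n)%N by rewrite -ltnS.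
rewrite subSS subKn // [dcoef p m * _]mulrC; congr (_ * _).
by rewrite -{1}(subnKC le_mn) Ccoef_sym subnK.
Qed.

Lemma dmulDl : left_distributive (dmul pi) +%R.
Proof.
move=> p q r; apply: dcoefP => n.
rewrite dcoefD !dcoefM -big_split; apply: eq_bigr => m _.
by rewrite dcoefD !mulrDl.
Qed.

Lemma dcoefM_mon (p : gdpa) c m n :
  dcoef (dmul pi p (dmon c m)) n
  = if (m <= n)%N then dcoef p (n - m) * c * Ccoef pi n m else 0.
Proof.
rewrite dcoefM; case: leqP => [le_mn | lt_nm].
  rewrite (bigD1 (Ordinal (le_mn : (m < n.+1)%N))) //= dcoef_mon eqxx.
  rewrite big1 ?addr0 // => i /negP ne; rewrite dcoef_mon.
  case: eqP => [E|_]; last by rewrite mulr0 mul0r.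
  by case: ne; apply/eqP/val_inj.
rewrite big1 // => i _; rewrite dcoef_mon.
by rewrite ltn_eqF ?mulr0 ?mul0r //; apply: leq_trans lt_nm.
Qed.

Lemma dmul_mon b m c n :
  dmul pi (dmon b m) (dmon c n) = dmon (b * c * Ccoef pi (m + n) n) (m + n).
Proof.
apply: dcoefP => d; rewrite dcoefM_mon !dcoef_mon.
case: leqP => [le_nd | lt_dn].
  rewrite -(eqn_add2r n) subnK //.
  by case: eqP => [->|_]; rewrite ?mulr1n // !mul0r.
by rewrite ltn_eqF // ltn_addl.
Qed.

Lemma dmul0l p : dmul pi 0 p = 0.
Proof. by apply: (addrI (dmul pi 0 p)); rewrite -dmulDl !addr0. Qed.

Lemma dmulA : associative (dmul pi).
Proof.
have dDr p q r : dmul pi p (q + r) = dmul pi p q + dmul pi p r.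
  by rewrite dmulC dmulDl !(dmulC _ p).
have d0r p : dmul pi p 0 = 0 by rewrite dmulC dmul0l.
move=> p q r; elim/dmon_ind: p => [|p p' IHp IHp'|a l].
- by rewrite !dmul0l.
- by rewrite !dmulDl IHp IHp'.
elim/dmon_ind: q => [|q q' IHq IHq'|b m].
- by rewrite !(dmul0l, d0r).
- by rewrite !(dmulDl, dDr) IHq IHq'.
elim/dmon_ind: r => [|r r' IHr IHr'|c n].
- by rewrite !d0r.
- by rewrite !dDr IHr IHr'.
rewrite !dmul_mon addnA; congr dmon.
have := Ccoef_cocycle pi l m n; set C1 := Ccoef _ _ _; set C2 := Ccoef _ _ _.
move=> E; transitivity (a * b * c * (C1 * C2)); last by ring.
by rewrite E; ring.
Qed.

Lemma dmul1l : left_id (dmon 1 0) (dmul pi).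
Proof.
move=> p; rewrite dmulC; apply: dcoefP => n.
by rewrite dcoefM_mon subn0 Ccoef0 !mulr1.
Qed.

Lemma dmon1_neq0 : dmon 1 0 != 0.
Proof. by rewrite /dmon expr0 mulr1 polyC_eq0 oner_neq0. Qed.

HB.instance Definition _ :=
  GRing.Zmodule_isComNzRing.Build gdpa dmulA dmulC dmul1l dmulDl dmon1_neq0.

Lemma dmulE (p q : gdpa) : p * q = dmul pi p q.
Proof. by []. Qed.

Lemma dmonM b m c n : dmon b m * dmon c n = dmon (b * c * Ccoef pi (m + n) n) (m + n).
Proof. exact: dmul_mon. Qed.

Lemma dmonD b c n : dmon (b + c) n = dmon b n + dmon c n.
Proof. by rewrite /dmon polyCD; apply: (mulrDl (b%:P : {poly k})). Qed.

Lemma dmon0 n : dmon 0 n = 0.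
Proof. by rewrite /dmon polyC0; apply: (mul0r ('X^n : {poly k})). Qed.

Lemma dcompE d (p : gdpa) : dcomp d p = dmon (dcoef p d) d.
Proof. by []. Qed.

Lemma polyC_dmon (c : k) : (c%:P : gdpa) = dmon c 0.
Proof. by rewrite /dmon expr0 mulr1. Qed.

End Ring.

(** * Transforms *)

Lemma dvdn_gcd_transform h m j : (0 < h)%N ->
  (m %/ gcdn m h %| j)%N = (m %| h * j)%N.
Proof.
move=> h0; have g0 : (0 < gcdn m h)%N by rewrite gcdn_gt0 h0 orbT.
have Em := divnK (dvdn_gcdl m h); have Eh := divnK (dvdn_gcdr m h).
have co : coprime (m %/ gcdn m h) (h %/ gcdn m h).
  by rewrite /coprime -(eqn_pmul2r g0) muln_gcdl Em Eh mul1n.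
by rewrite -(Gauss_dvdr j co) -(dvdn_pmul2r g0) Em mulnAC Eh.
Qed.

Section Transform.
Variable k : comNzRingType.
Implicit Types pi : nat -> k.

(** The map from [(m, d)] to [d * m] is a bijection onto the divisors of [h * n]: coprimality gives
    [gcdn (d * m) h = d], so the inverse sends [m] to [m %/ gcdn m h] and [gcdn m h]. *)
Lemma big_transform (F : nat -> k) (P : pred nat) h n : (0 < h)%N -> (0 < n)%N ->
  \prod_(m <- divisors n | P m) \prod_(d <- divisors h | coprime (h %/ d) m) F (d * m)%N
  = \prod_(m <- divisors (h * n) | P (m %/ gcdn m h)%N) F m.
Proof.
move=> h0 n0; have hn0 : (0 < h * n)%N by rewrite muln_gt0 h0.
have cancel d m : (d %| h)%N -> coprime (h %/ d) m -> gcdn (d * m) h = d.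
  move=> dh /eqP co.
  by rewrite -[X in gcdn _ X](divnK dh) mulnC -muln_gcdl gcdnC co mul1n.
rewrite -big_filter.
under eq_bigr do rewrite -big_filter.
rewrite -(big_allpairs_dep (h := fun m d => (d * m)%N)) -[RHS]big_filter.
apply: perm_big; apply: uniq_perm; last 1 first.
- move=> m; rewrite mem_filter -dvdn_divisors //; apply/allpairsPdep/idP.
    case=> [m' [d []]]; rewrite !mem_filter -!dvdn_divisors //.
    case/andP=> Pm' m'n /andP[co dh] ->.
    have d0 : (0 < d)%N by apply: dvdn_gt0 dh.
    by rewrite cancel // mulKn // Pm' dvdn_mul.
  case/andP=> Pm mhn; exists (m %/ gcdn m h)%N, (gcdn m h).
  have g0 : (0 < gcdn m h)%N by rewrite gcdn_gt0 h0 orbT.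
  rewrite !mem_filter -!dvdn_divisors // Pm dvdn_gcd_transform // mhn dvdn_gcdr.
  rewrite [(gcdn _ _ * _)%N]mulnC divnK ?dvdn_gcdl //; split=> //.
  rewrite andbT coprime_sym /coprime -(eqn_pmul2r g0) mul1n muln_gcdl.
  by rewrite !divnK ?dvdn_gcdl ?dvdn_gcdr.
- apply: allpairs_uniq_dep; rewrite ?filter_uniq ?divisors_uniq //.
    by move=> m _; rewrite filter_uniq ?divisors_uniq.
  move=> _ _ /allpairsPdep[m [d [_ dm ->]]] /allpairsPdep[m' [d' [_ dm' ->]]] /=.
  move: dm dm'; rewrite !mem_filter -!dvdn_divisors // => /andP[co dh] /andP[co' dh'] E.
  have Ed : d = d' by rewrite -(cancel _ _ dh co) E cancel.
  move: E; rewrite Ed => /eqP; rewrite eqn_pmul2l ?(dvdn_gt0 _ dh') //.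
  by move/eqP => ->.
- by rewrite filter_uniq ?divisors_uniq.
Qed.

(* When the nonunits among the [pi_m] form a chain through [j], this is, up to
   a unit, the product of the [pi_m] with [j] strictly dividing [m] and [m]
   dividing [j * q]. *)
Definition arel pi j q : k := \prod_(m <- divisors (j * q) | ~~ (m %| j)%N) pv pi m.

Lemma pv_ge2 pi n : (2 <= n)%N -> pv pi n = pi n.
Proof. by rewrite /pv => ->. Qed.

Lemma pv_htrans pi h m : (2 <= m)%N ->
  pv (htrans pi h) m
  = \prod_(d <- divisors h | coprime (h %/ d) m) pv pi (d * m).
Proof.
by move=> m2; rewrite pv_ge2.
Qed.

(** The bijection of [big_transform] carries the condition [m %| j] to [m %| h * j]. Since 1 is
    among the excluded indices, the convention for [pi_1] never enters. Torsion of the [h]-transform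
    relative to [j] is thus torsion of the [h * j]-transform. *)
Lemma arel_htrans pi h j q : (0 < h)%N -> (0 < j)%N -> (0 < q)%N ->
  arel (htrans pi h) j q = arel pi (h * j) q.
Proof.
move=> h0 j0 q0; rewrite /arel -mulnA.
transitivity (\prod_(m <- divisors (j * q) | ~~ (m %| j)%N)
  \prod_(d <- divisors h | coprime (h %/ d) m) pv pi (d * m)).
  rewrite big_seq_cond [RHS]big_seq_cond; apply: eq_bigr => m /andP[].
  rewrite -dvdn_divisors ?muln_gt0 ?j0 // => mjq mj; apply: pv_htrans.
  have : (0 < m)%N by apply: dvdn_gt0 mjq; rewrite muln_gt0 j0.
  by case: m mj {mjq} => [|[|m]] //; rewrite dvd1n.
rewrite big_transform ?muln_gt0 ?j0 //.
by apply: eq_bigl => m; rewrite dvdn_gcd_transform.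
Qed.

Lemma a_fun_htrans pi h n : (0 < h)%N -> (0 < n)%N ->
  a_fun (htrans pi h) n = arel pi h n.
Proof.
move=> h0 n0; rewrite -[in RHS](muln1 h) -arel_htrans //.
by rewrite /arel mul1n; apply: eq_bigl => m; rewrite dvdn1.
Qed.

Lemma arel_dvd pi j q q' : (0 < j)%N -> (0 < q')%N -> (q %| q')%N ->
  exists c, arel pi j q' = c * arel pi j q.
Proof.
move=> j0 q0 qq'; have jq : (j * q %| j * q')%N by rewrite dvdn_pmul2l.
have q1 : (0 < q)%N by apply: dvdn_gt0 qq'.
exists (\prod_(m <- divisors (j * q') | ~~ (m %| j)%N && ~~ (m %| j * q)%N) pv pi m).
rewrite /arel [LHS](bigID (fun m => (m %| j * q)%N)) /= mulrC; congr (_ * _).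
rewrite -[LHS]big_filter -[RHS]big_filter; apply: perm_big.
apply: uniq_perm; rewrite ?filter_uniq ?divisors_uniq // => m.
rewrite !mem_filter -!dvdn_divisors ?muln_gt0 ?j0 //.
by case: (boolP (m %| j * q)%N) => [/dvdn_trans/(_ jq) ->|_]; rewrite ?andbF ?andbT.
Qed.

Lemma a_fun_arel pi n : a_fun pi n = arel pi 1 n.
Proof. by rewrite /arel mul1n; apply: eq_bigl => m; rewrite dvdn1. Qed.

Lemma a_fun_dvd pi n n' : (0 < n')%N -> (n %| n')%N ->
  exists c, a_fun pi n' = c * a_fun pi n.
Proof. by rewrite !a_fun_arel; apply: arel_dvd. Qed.

Definition comax (x y : k) := exists u v, u * x + v * y = 1.

Lemma comaxC x y : comax x y -> comax y x.
Proof. by case=> u [v E]; exists v, u; rewrite addrC. Qed.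

Lemma comax1 x : comax x 1.
Proof. by exists 0, 1; rewrite mul0r add0r mulr1. Qed.

Lemma comaxM x y z : comax x y -> comax x z -> comax x (y * z).
Proof.
move=> [u [v E]] [u' [v' E']]; exists (u + v * y * u'), (v * v').
transitivity (u * x + v * y * (u' * x + v' * z)); first by ring.
by rewrite E' mulr1.
Qed.

Lemma comax_prod I (r : seq I) (P : pred I) (F : I -> k) x :
  (forall i, P i -> comax x (F i)) -> comax x (\prod_(i <- r | P i) F i).
Proof.
by move=> H; apply: big_ind => //; [exact: comax1 | move=> *; apply: comaxM].
Qed.

Lemma comax_exp x y e : comax x y -> comax x (y ^+ e).
Proof.
move=> H; elim: e => [|e IH]; first by rewrite expr0; apply: comax1.
by rewrite exprS; apply: comaxM.
Qed.

(** If [n] and [m] are incomparable, so are all [d * n] and [d' * m], because dividing [d * n] by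
    its gcd with [h] recovers [n]. The factors of the two products are then pairwise comaximal,
    hence so are the products. *)
Lemma admissible_htrans pi h : (0 < h)%N -> admissible pi -> admissible (htrans pi h).
Proof.
move=> h0 adm n m n1 m1 ncom; case: (ltnP 1 n) => [n2|]; last first.
  by case: n n1 {ncom} => [|[]] // *; left; rewrite dvd1n.
case: (ltnP 1 m) => [m2|]; last first.
  by case: m m1 {ncom} => [|[]] // *; right; rewrite dvd1n.
apply: NNPP => inc; apply: ncom.
rewrite !pv_htrans //.
have down d d' a b : (d %| h)%N -> (d' %| h)%N -> coprime (h %/ d) a ->
    coprime (h %/ d') b -> (d * a %| d' * b)%N -> (a %| b)%N.
  move=> dh d'h co co' dab.
  have E x y : (x %| h)%N -> coprime (h %/ x) y -> (x * y %/ gcdn (x * y) h = y)%N.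
    move=> xh /eqP co0; have x0 : (0 < x)%N by apply: dvdn_gt0 xh.
    have -> : gcdn (x * y) h = x.
      by rewrite -[X in gcdn _ X](divnK xh) mulnC -muln_gcdl gcdnC co0 mul1n.
    by rewrite mulKn.
  rewrite -(E d a) // dvdn_gcd_transform //; apply: dvdn_trans dab _.
  by apply: dvdn_mul.
have main d d' : (d %| h)%N -> (d' %| h)%N -> coprime (h %/ d) n ->
    coprime (h %/ d') m -> comax (pv pi (d * n)) (pv pi (d' * m)).
  move=> dh d'h co co'; apply: NNPP => nc.
  have d0 : (0 < d)%N by apply: dvdn_gt0 dh.
  have d'0 : (0 < d')%N by apply: dvdn_gt0 d'h.
  case: (adm (d * n)%N (d' * m)%N); rewrite ?muln_gt0 ?d0 ?d'0 //.
    by move/(down _ _ _ _ dh d'h co co'); tauto.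
  by move/(down _ _ _ _ d'h dh co' co); tauto.
rewrite !(big_seq_cond (fun d => coprime _ _)).
apply: comax_prod => d' /andP[]; rewrite -dvdn_divisors // => d'h co'.
apply: comaxC; apply: comax_prod => d /andP[]; rewrite -dvdn_divisors // => dh co.
exact/comaxC/main.
Qed.

End Transform.

(** * Relations between generators *)

Lemma finite_choice (T : Type) (P : nat -> T -> Prop) n (y0 : T) :
  (forall i, (i < n)%N -> exists y, P i y) ->
  exists f, forall i, (i < n)%N -> P i (f i).
Proof.
elim: n => [|n IH] H; first by exists (fun _ => y0).
have [f fP] := IH (fun i lt_in => H i (ltnW lt_in)).
have [y yP] := H n (leqnn _).
exists (fun i => if i == n then y else f i) => i.
by rewrite ltnS leq_eqVlt; case: eqP => [->|_ /fP].
Qed.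

Section In.
Variable T : Type.
Implicit Type s : seq T.

Lemma nth_In x0 s j : (j < size s)%N -> List.In (nth x0 s j) s.
Proof. by elim: s j => //= x s IH [|j] lt_j; [left | right; apply: IH]. Qed.

Lemma In_nth x0 s x : List.In x s -> exists2 j, (j < size s)%N & nth x0 s j = x.
Proof.
elim: s => //= y s IH [->|/IH[j lt_j E]]; first by exists 0%N.
by exists j.+1.
Qed.

End In.

Section Syzygies.
Variable R : comNzRingType.
Implicit Types (s t : seq R) (f g r : nat -> R).

Definition lin s f : R := \sum_(i < size s) f i * s`_i.

(** Vectors of length [n] are functions on [nat] whose values from [n] on are ignored; [rspan_ext]
    builds this equality into the span. *)
Inductive rspan (n : nat) (G : (nat -> R) -> Prop) : (nat -> R) -> Prop :=
| rspan_gen g : G g -> rspan n G g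
| rspan0 : rspan n G (fun _ => 0)
| rspan_lin a f g : rspan n G f -> rspan n G g -> rspan n G (fun i => a * f i + g i)
| rspan_ext f g : (forall i, (i < n)%N -> f i = g i) -> rspan n G f -> rspan n G g.

Definition is_zero (x : R) : Prop := x = 0.

Definition fg_rel s := exists rs : seq (nat -> R),
  (forall r, List.In r rs -> lin s r = 0) /\
  (forall f, lin s f = 0 -> rspan (size s) (fun g => List.In g rs) f).

Lemma eq_lin s f g : (forall i, (i < size s)%N -> f i = g i) -> lin s f = lin s g.
Proof. by move=> E; apply: eq_bigr => i _; rewrite E. Qed.

Lemma lin_comb s a f g : lin s (fun i => a * f i + g i) = a * lin s f + lin s g.
Proof.
rewrite /lin mulr_sumr -big_split; apply: eq_bigr => i _ /=.
by rewrite mulrDl mulrA.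
Qed.

Lemma lin0 s : lin s (fun _ => 0) = 0.
Proof. by rewrite /lin big1 // => i _; rewrite mul0r. Qed.

Lemma linN s f : lin s (fun i => - f i) = - lin s f.
Proof. by rewrite /lin -sumrN; apply: eq_bigr => i _; rewrite mulNr. Qed.

Lemma lin_sum s n (F : nat -> nat -> R) :
  lin s (fun i => \sum_(j < n) F j i) = \sum_(j < n) lin s (F j).
Proof.
rewrite /lin exchange_big /=; apply: eq_bigr => i _.
by rewrite mulr_suml.
Qed.

Lemma lin_mkseq s f : lcomb *%R (mkseq f (size s)) s = lin s f.
Proof. by apply: eq_bigr => i _; rewrite nth_mkseq. Qed.

Lemma lin_unit s i : (i < size s)%N -> lin s (fun j => (j == i)%:R) = s`_i.
Proof.
move=> lt_i; rewrite /lin (bigD1 (Ordinal lt_i)) //= eqxx mul1r big1 ?addr0 //.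
by move=> j; rewrite -val_eqE /= => /negPf ->; rewrite mul0r.
Qed.

Lemma lin_cons x s f : lin (x :: s) f = f 0%N * x + lin s (fun i => f i.+1).
Proof. by rewrite /lin big_ord_recl. Qed.

Lemma lin_cat s t f :
  lin (s ++ t) f = lin s f + lin t (fun i => f (size s + i)%N).
Proof.
rewrite /lin size_cat big_split_ord /=; congr (_ + _); apply: eq_bigr => i _ /=.
  by rewrite nth_cat ltn_ord.
by rewrite nth_cat ltnNge leq_addr addKn.
Qed.

Lemma gen_modP s x : gen_mod *%R is_zero s x <-> exists f, x = lin s f.
Proof.
split=> [[c /eqP]|[f ->]]; first by rewrite subr_eq0 => /eqP ->; exists (nth 0 c).
by exists (mkseq f (size s)); rewrite /is_zero lin_mkseq subrr.
Qed.

Lemma gen_lin s f : gen_mod *%R is_zero s (lin s f).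
Proof. by apply/gen_modP; exists f. Qed.

Lemma gen_nth s i : gen_mod *%R is_zero s s`_i.
Proof.
case: (ltnP i (size s)) => [lt_i | le_i].
  by rewrite -(lin_unit lt_i); apply: gen_lin.
by rewrite nth_default // -(lin0 s); apply: gen_lin.
Qed.

Lemma gen_mod_comb s a x y : gen_mod *%R is_zero s x -> gen_mod *%R is_zero s y ->
  gen_mod *%R is_zero s (a * x + y).
Proof.
move=> /gen_modP[f ->] /gen_modP[g ->]; rewrite -lin_comb; exact: gen_lin.
Qed.

Lemma gen_mod0 s : gen_mod *%R is_zero s 0.
Proof. by rewrite -(lin0 s); apply: gen_lin. Qed.

Lemma gen_modD s x y : gen_mod *%R is_zero s x -> gen_mod *%R is_zero s y ->
  gen_mod *%R is_zero s (x + y).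
Proof. by move=> gx; rewrite -[x]mul1r; apply: gen_mod_comb. Qed.

Lemma gen_modM s a x : gen_mod *%R is_zero s x -> gen_mod *%R is_zero s (a * x).
Proof. by move=> gx; rewrite -[_ * _]addr0; apply/gen_mod_comb/gen_mod0. Qed.

Lemma gen_mod_sum s I (r : seq I) (P : pred I) (F : I -> R) :
  (forall i, P i -> gen_mod *%R is_zero s (F i)) ->
  gen_mod *%R is_zero s (\sum_(i <- r | P i) F i).
Proof. by move=> H; apply: big_ind => //; [apply: gen_mod0|apply: gen_modD]. Qed.

Lemma gen_mod_sub s t : (forall i, (i < size s)%N -> gen_mod *%R is_zero t s`_i) ->
  forall x, gen_mod *%R is_zero s x -> gen_mod *%R is_zero t x.
Proof.
move=> H x /gen_modP[f ->]; apply: gen_mod_sum => i _.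
exact/gen_modM/H.
Qed.

Lemma rspanD n G f g : rspan n G f -> rspan n G g -> rspan n G (fun i => f i + g i).
Proof.
move=> Gf Gg; apply: rspan_ext (rspan_lin 1 Gf Gg) => i _.
by rewrite mul1r.
Qed.

Lemma rspanZ n G a f : rspan n G f -> rspan n G (fun i => a * f i).
Proof.
move=> Gf; apply: rspan_ext (rspan_lin a Gf (rspan0 _ _)) => i _.
by rewrite addr0.
Qed.

Lemma rspan_sum n G m (F : nat -> nat -> R) :
  (forall j, (j < m)%N -> rspan n G (F j)) -> rspan n G (fun i => \sum_(j < m) F j i).
Proof.
elim: m => [|m IH] H.
  by apply: rspan_ext (rspan0 _ _) => i _; rewrite big_ord0.
apply: rspan_ext (rspanD (IH _) (H m (leqnn _))) => [i _|j lt_j].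
  by rewrite big_ord_recr.
exact/H/ltnW.
Qed.

Lemma rspan_map n m (G G' : (nat -> R) -> Prop) (Phi : (nat -> R) -> nat -> R) :
  (forall f g, (forall i, (i < n)%N -> f i = g i) -> forall i, Phi f i = Phi g i) ->
  (forall i, Phi (fun _ => 0) i = 0) ->
  (forall a f g i, Phi (fun i => a * f i + g i) i = a * Phi f i + Phi g i) ->
  (forall g, G g -> rspan m G' (Phi g)) ->
  forall f, rspan n G f -> rspan m G' (Phi f).
Proof.
move=> Pext P0 Plin PG f; elim=> {f} [g /PG //||a f g _ IHf _ IHg|f g E _ IHf].
- by apply: rspan_ext (rspan0 _ _) => i _; rewrite P0.
- by apply: rspan_ext (rspan_lin a IHf IHg) => i _; rewrite Plin.
- by apply: rspan_ext IHf => i _; apply: Pext.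
Qed.

Lemma rspan_sub n (G G' : (nat -> R) -> Prop) f :
  (forall g, G g -> rspan n G' g) -> rspan n G f -> rspan n G' f.
Proof.
move=> sub; elim=> {f} [g /sub //||a f g _ IHf _ IHg|f g E _ IHf].
- exact: rspan0.
- exact: rspan_lin.
- exact: rspan_ext IHf.
Qed.

Lemma rspan_combination n rs f : rspan n (fun g => List.In g rs) f ->
  exists d : seq R, forall i, (i < n)%N ->
    f i = \sum_(j < size rs) d`_j * nth (fun _ => 0) rs j i.
Proof.
elim=> {f} [g||a f g _ [d Ed] _ [d' Ed']|f g E _ [d Ed]].
- case/(In_nth (fun _ => 0)) => j lt_j <-; exists (mkseq (fun l => (l == j)%:R) (size rs)).
  move=> i _; rewrite (bigD1 (Ordinal lt_j)) //= nth_mkseq // eqxx mul1r.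
  rewrite big1 ?addr0 // => l; rewrite -val_eqE /= => /negPf ne.
  by rewrite nth_mkseq // ne mul0r.
- by exists [::] => i _; rewrite big1 // => j _; rewrite nth_nil mul0r.
- exists (mkseq (fun j => a * d`_j + d'`_j) (size rs)) => i lt_i.
  rewrite Ed // Ed' // mulr_sumr -big_split; apply: eq_bigr => j _ /=.
  by rewrite nth_mkseq // mulrDl mulrA.
- by exists d => i lt_i; rewrite -E // Ed.
Qed.

Lemma fg_relP s : fg_rel s <-> fg_syz_mod *%R is_zero s.
Proof.
split=> -[rs [rs0 rsP]].
  exists (map (fun r => mkseq r (size s)) rs); rewrite size_map; split.
    move=> j lt_j; rewrite (nth_map (fun _ => 0)) //.
    split; first by rewrite size_mkseq.
    by rewrite /is_zero lin_mkseq; apply/rs0/nth_In.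
  move=> c [sc c0]; have [d Ed] := rspan_combination (rsP (nth 0 c) c0).
  exists d => i lt_i; apply/eqP; rewrite subr_eq0 Ed //; apply/eqP.
  by apply: eq_bigr => j _; rewrite (nth_map (fun _ => 0)) // nth_mkseq.
exists (map (nth 0) rs); split.
  move=> r /(In_nth (fun _ => 0))[j]; rewrite size_map => lt_j <-.
  rewrite (nth_map [::]) //; have [_ ] := rs0 _ lt_j; exact.
move=> f f0; have [|d Ed] := rsP (mkseq f (size s)).
  by split; rewrite ?size_mkseq // /is_zero lin_mkseq.
apply: (@rspan_ext _ _ (fun i => \sum_(j < size rs) d`_j * (nth [::] rs j)`_i)).
  by move=> i lt_i; have /eqP := Ed i lt_i; rewrite nth_mkseq // subr_eq0 => /eqP ->.
apply: (@rspan_sum _ _ _ (fun j i => d`_j * (nth [::] rs j)`_i)) => j lt_j.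
apply: (@rspanZ _ _ _ (nth 0 (nth [::] rs j))); apply: rspan_gen.
have {1}-> : nth 0 (nth [::] rs j) = nth (fun _ => 0) (map (nth 0) rs) j.
  by rewrite (nth_map [::]).
by apply: nth_In; rewrite size_map.
Qed.

(* Schanuel's lemma: with [s = A t] and [t = B s], the relations of [s] are
   generated by the rows of [1 - A B] and the images under [B] of the relations
   of [t]. *)
Lemma fg_rel_change s t :
  (forall x, gen_mod *%R is_zero s x <-> gen_mod *%R is_zero t x) ->
  fg_rel t -> fg_rel s.
Proof.
move=> Est [rs [rs0 rsP]].
have [A EA] : exists A, forall i, (i < size s)%N -> s`_i = lin t (A i).
  apply: (finite_choice (P := fun i y => s`_i = lin t y)) => [|i _].
    by exact: (fun _ => 0).
  exact/gen_modP/Est/gen_nth.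
have [B EB] : exists B, forall j, (j < size t)%N -> t`_j = lin s (B j).
  apply: (finite_choice (P := fun j y => t`_j = lin s y)) => [|j _].
    by exact: (fun _ => 0).
  exact/gen_modP/Est/gen_nth.
pose Phi (g : nat -> R) (i : nat) := \sum_(j < size t) g j * B j i.
have linPhi g : lin s (Phi g) = lin t g.
  rewrite /Phi (lin_sum s (size t) (fun j i => g j * B j i)); apply: eq_bigr => j _; rewrite EB //.
  by rewrite /lin mulr_sumr; apply: eq_bigr => i _; rewrite mulrA.
pose delta (i i' : nat) : R := (i' == i)%:R.
pose eps i i' : R := delta i i' - Phi (A i) i'.
exists (map eps (iota 0 (size s)) ++ map Phi rs); split.
  move=> r /(@List.in_app_or _ _ _ _)[] /(@List.in_map_iff _ _ _ _ _)[x [<- xP]].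
    have lt_x : (x < size s)%N.
      have [j] := In_nth 0%N xP; rewrite size_iota => lt_j <-.
      by rewrite nth_iota.
    rewrite (eq_lin (g := fun i => -1 * Phi (A x) i + delta x i)); last first.
      by move=> i _; rewrite mulN1r addrC.
    by rewrite lin_comb linPhi lin_unit // EA // mulN1r addNr.
  by rewrite linPhi rs0.
move=> f f0; pose g j := \sum_(i < size s) f i * A i j.
have g0 : lin t g = 0.
  rewrite -f0 /g (lin_sum t (size s) (fun i j => f i * A i j)); apply: eq_bigr => i _; rewrite EA //.
  by rewrite /lin mulr_sumr; apply: eq_bigr => j _; rewrite mulrA.
set G := fun _ => _.
apply: (@rspan_ext _ _ (fun i' => \sum_(i < size s) f i * eps i i' + Phi g i')).
  move=> i' lt_i'; rewrite /eps; under eq_bigr do rewrite mulrBr.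
  rewrite sumrB /delta (bigD1 (Ordinal lt_i')) //= eqxx mulr1.
  rewrite [X in _ + X - _]big1 ?addr0; last first.
    by move=> j; rewrite -val_eqE /= eq_sym => /negPf ->; rewrite mulr0.
  suff -> : Phi g i' = \sum_(i < size s) f i * Phi (A i) i' by rewrite subrK.
  rewrite /Phi /g; under eq_bigr do rewrite mulr_suml.
  rewrite exchange_big /=; apply: eq_bigr => i _; rewrite mulr_sumr.
  by apply: eq_bigr => j _; rewrite mulrA.
apply: rspanD.
  apply: (@rspan_sum _ _ _ (fun i i' => f i * eps i i')) => i lt_i.
  apply/rspanZ/rspan_gen/(@List.in_or_app _ _ _ _); left.
  have -> : i = nth 0%N (iota 0 (size s)) i by rewrite nth_iota.
  by apply/List.in_map/nth_In; rewrite size_iota.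
apply: (rspan_map (n := size t) (G := fun g => List.In g rs)) (rsP _ g0).
- by move=> h h' E i; apply: eq_bigr => j _; rewrite E.
- by move=> i; rewrite /Phi big1 // => j _; rewrite mul0r.
- move=> a h h' i; rewrite /Phi mulr_sumr -big_split; apply: eq_bigr => j _ /=.
  by rewrite mulrDl mulrA.
- move=> h hP; apply/rspan_gen/(@List.in_or_app _ _ _ _); right.
  exact: List.in_map.
Qed.

Lemma fg_rel_fp (I : R -> Prop) s : (forall x, I x <-> gen_mod *%R is_zero s x) ->
  fp_mod *%R is_zero I -> fg_rel s.
Proof.
move=> Is [t [It /fg_relP]]; apply: fg_rel_change => x.
by split=> [/Is/It|/It/Is].
Qed.

(** * Relations modulo a finitely generated ideal *)

Section Quotient.
Variables (J : R -> Prop) (t : seq R).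
Hypothesis Jt : forall x, J x <-> gen_mod *%R is_zero t x.

Lemma gen_mod_quotient s x :
  gen_mod *%R J s x <-> gen_mod *%R is_zero (s ++ t) x.
Proof.
split.
  case=> c /Jt/gen_modP[f Ef].
  have -> : x = lin s (nth 0 c) + lin t f by rewrite -Ef addrC subrK.
  apply/gen_modP; exists (fun i => if (i < size s)%N then c`_i else f (i - size s)%N).
  rewrite lin_cat; congr (_ + _); apply: eq_lin => i lt_i; first by rewrite lt_i.
  by rewrite ltnNge leq_addr addKn.
case/gen_modP=> f ->; exists (mkseq f (size s)); apply/Jt.
by rewrite lin_cat lin_mkseq addrC addKr; apply: gen_lin.
Qed.

(** A relation of [s] modulo [J] becomes a true relation of [s ++ t] once its value in [J] is
    written through [t]; truncation to the first [size s] coordinates goes back. *)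
Lemma fg_syz_quotient s :
  fg_syz_mod *%R is_zero (s ++ t) -> fg_syz_mod *%R J s.
Proof.
case=> rs [rs0 rsP]; exists (map (take (size s)) rs); rewrite size_map.
split=> [j lt_j|c [sc /Jt/gen_modP[e Ee]]].
  rewrite (nth_map [::]) //; have [] := rs0 j lt_j.
  set r := nth _ _ _ => sz r0; rewrite size_cat in sz; split.
    by rewrite size_takel ?sz ?leq_addr.
  have {}r0 : lin (s ++ t) (nth 0 r) = 0 := r0.
  apply/Jt/gen_modP; exists (fun i => - nth 0 r (size s + i)%N).
  rewrite linN; apply/eqP; rewrite -addr_eq0; apply/eqP; rewrite -[RHS]r0 lin_cat.
  congr (_ + _); rewrite -[LHS]/(lin s (nth 0 (take (size s) r))).
  by apply: eq_lin => i lt_i; rewrite nth_take.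
have [|d dP] := rsP (c ++ mkseq (fun i => - e i) (size t)).
  split; first by rewrite !size_cat size_mkseq sc.
  rewrite /is_zero -[lcomb _ _ _]/(lin (s ++ t) (nth 0 _)) lin_cat.
  apply/eqP; rewrite addr_eq0 -linN; apply/eqP.
  transitivity (lin s (nth 0 c)); first by apply: eq_lin => i; rewrite nth_cat sc => ->.
  rewrite -[LHS]/(lcomb *%R c s) Ee; apply: eq_lin => i lt_i.
  by rewrite nth_cat sc ltnNge leq_addr addKn nth_mkseq // opprK.
exists d => i lt_i; have := dP i; rewrite size_cat ltn_addr // nth_cat sc lt_i.
move=> /(_ isT) E; apply/Jt; rewrite [X in gen_mod _ _ _ X](_ : _ = 0).
  exact: gen_mod0.
rewrite -[RHS]E; congr (_ - _); apply: eq_bigr => j _.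
by rewrite (nth_map [::]) // nth_take.
Qed.

End Quotient.

End Syzygies.

(** * Necessity *)

Section Monomials.
Variable k : comNzRingType.
Variable pi : nat -> k.
Local Notation D := (gdpa pi).
Implicit Types (cs : seq (k * nat)) (t : seq k).

Definition dmons cs : seq D := map (fun c => dmon pi c.1 c.2) cs.
Definition cst cs i : k := (nth (0, 0%N) cs i).1.
Definition deg cs i : nat := (nth (0, 0%N) cs i).2.

Lemma size_dmons cs : size (dmons cs) = size cs.
Proof. exact: size_map. Qed.

Lemma nth_dmons cs i : (i < size cs)%N -> (dmons cs)`_i = dmon pi (cst cs i) (deg cs i).
Proof. by move=> lt_i; rewrite (nth_map (0, 0%N)). Qed.

Lemma dcoef_lin cs (f : nat -> D) n :
  dcoef (lin (dmons cs) f) n = \sum_(i < size cs)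
    if (deg cs i <= n)%N
    then dcoef (f i) (n - deg cs i) * cst cs i * Ccoef pi n (deg cs i) else 0.
Proof.
rewrite /lin dcoef_sum size_dmons; apply: eq_bigr => i _.
by rewrite nth_dmons // dmulE dcoefM_mon.
Qed.

Lemma dmon_sumr I (r : seq I) (F : I -> k) n :
  \sum_(i <- r) dmon pi (F i) n = dmon pi (\sum_(i <- r) F i) n.
Proof.
apply/esym/(big_morph (fun x => dmon pi x n)) => [x y|].
  exact: dmonD.
exact: dmon0.
Qed.

Lemma homogeneous_gen_dmons cs (I : D -> Prop) :
  (forall x, I x <-> gen_mod *%R (@is_zero D) (dmons cs) x) ->
  homogeneous_mod (@dcomp k) I.
Proof.
move=> EI p /EI/gen_modP[f ->] d; apply/EI/gen_modP.
exists (fun i => if (deg cs i <= d)%N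
  then dmon pi (dcoef (f i) (d - deg cs i)) (d - deg cs i) else 0).
rewrite dcompE dcoef_lin -dmon_sumr /lin size_dmons.
apply: eq_bigr => i _; rewrite nth_dmons //.
by case: ifP => [le_i|_]; rewrite ?mul0r ?dmon0 // dmonM subnK.
Qed.

Lemma graded_coherent_rel cs :
  D_graded_coherent pi (fun p => p = 0) -> fg_rel (dmons cs).
Proof.
move=> coh; pose I x := gen_mod *%R (@is_zero D) (dmons cs) x.
apply: (fg_rel_fp (I := I)) => //; apply: coh; last by exists (dmons cs).
exact: (@homogeneous_gen_dmons cs).
Qed.

Definition dconst t : seq D := dmons [seq (x, 0%N) | x <- t].

Lemma size_dconst t : size (dconst t) = size t.
Proof. by rewrite size_dmons size_map. Qed.

Lemma cst_const t i : cst [seq (x, 0%N) | x <- t] i = t`_i.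
Proof.
case: (ltnP i (size t)) => [lt_i|le_i]; first by rewrite /cst (nth_map 0).
by rewrite /cst !nth_default ?size_map.
Qed.

Lemma deg_const t i : deg [seq (x, 0%N) | x <- t] i = 0%N.
Proof.
case: (ltnP i (size t)) => [lt_i|le_i]; first by rewrite /deg (nth_map 0).
by rewrite /deg nth_default ?size_map.
Qed.

Lemma nth_dconst t i : (i < size t)%N -> (dconst t)`_i = dmon pi t`_i 0.
Proof. by move=> lt_i; rewrite nth_dmons ?size_map // cst_const deg_const. Qed.

Lemma dcoef_lin_const t (f : nat -> D) n :
  dcoef (lin (dconst t) f) n = lin t (fun i => dcoef (f i) n).
Proof.
rewrite dcoef_lin size_map; apply: eq_bigr => i _.
by rewrite deg_const /= subn0 Ccoef0 mulr1 cst_const.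
Qed.

Lemma dconst_polyC t : dconst t = map polyC t.
Proof.
by rewrite /dconst /dmons -map_comp; apply: eq_map => x; rewrite polyC_dmon.
Qed.

Lemma ext_idealP (A : k -> Prop) t : (forall x, A x <-> kgen t x) -> forall p,
  ext_ideal pi A p <-> gen_mod *%R (@is_zero D) (dconst t) p.
Proof.
move=> At p; split=> [[s [sA]]|tp]; last first.
  exists t; split; first by move=> i _; apply/At/gen_nth.
  by move: tp; rewrite dconst_polyC.
have -> : map polyC s = dconst s by rewrite dconst_polyC.
apply: (@gen_mod_sub D (dconst s) (dconst t) _ p) => i.
rewrite size_dconst => lt_i; apply/gen_modP.
have /At/gen_modP[f Ef] := sA i lt_i.
exists (fun j => dmon pi (f j) 0); apply: dcoefP => n.
rewrite dcoef_lin_const nth_dconst // dcoef_mon Ef /lin -sumrMnl.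
by apply: eq_bigr => j _; rewrite dcoef_mon mulrnAl.
Qed.

End Monomials.

Section Necessity.
Variables (k : comNzRingType) (pi : nat -> k).
Hypothesis coh : D_graded_coherent pi (fun p => p = 0).
Local Notation D := (gdpa pi).

(** Taking the coefficient in degree 0 is a ring morphism from [D] to [k], the identity on
    constants. It sends generators of the relations over [D] between constants to generators of
    those over [k]. *)
Lemma base_coherent : coherent_ring k.
Proof.
move=> I [s Is]; exists s; split=> //; apply/fg_relP.
have [rs [rs0 rsP]] := graded_coherent_rel [seq (x, 0%N) | x <- s] coh.
rewrite -/(dconst pi s) in rs0 rsP.
exists (map (fun r i => dcoef (r i) 0) rs); split.
  move=> r /(@List.in_map_iff _ _ _ _ _)[x [<- xP]].
  by rewrite -dcoef_lin_const rs0 // dcoef0.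
move=> f f0.
have : rspan (size s) (fun g => List.In g rs) (fun i => dmon pi (f i) 0).
  rewrite -(size_dconst pi s); apply: rsP; apply: dcoefP => n.
  rewrite dcoef_lin_const dcoef0 -[RHS](mul0rn k (n == 0)%N) -f0 /lin -sumrMnl.
  by apply: eq_bigr => i _; rewrite dcoef_mon mulrnAl.
suff H g : rspan (size s) (fun g => List.In g rs) g ->
    rspan (size s) (fun g => List.In g (map (fun r i => dcoef (r i) 0) rs))
      (fun i => dcoef (g i) 0).
  by move/H; apply: rspan_ext => i _; rewrite dcoef_mon mulr1n.
elim=> {g} [g gP||a f1 g1 _ IHf _ IHg|g g1 E _ IH].
- by apply/rspan_gen/(List.in_map (fun r i => dcoef (r i) 0)).
- by apply: rspan_ext (rspan0 _ _) => i _; rewrite dcoef0.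
- apply: rspan_ext (rspan_lin (dcoef a 0) IHf IHg) => i _.
  by rewrite dcoefD dmulE dcoefM big_ord1 subn0 Ccoef0 mulr1.
- by apply: rspan_ext IH => i lt_i; rewrite E.
Qed.

(** The relations between [x^[1]] and the constants [t] have finitely many generators, so the
    degrees of the first coordinates of these are bounded; and every torsion element modulo [t] is a
    coefficient in the first coordinate of some relation. *)
Lemma torsion_bounded t : exists n : nat, (1 <= n)%N /\
  forall x m, (1 <= m)%N -> kgen t (a_fun pi m * x) -> kgen t (a_fun pi n * x).
Proof.
have [rs [rs0 rsP]] := graded_coherent_rel ((1, 1%N) :: [seq (x, 0%N) | x <- t]) coh.
have [M Mr] : exists M, forall r, List.In r rs -> (size (r 0%N : {poly k}) <= M)%N.
  elim: rs {rs0 rsP} => [|r rs [M IH]]; first by exists 0%N.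
  exists (maxn (size (r 0%N : {poly k})) M) => r' [<-|/IH le_M].
    exact: leq_maxl.
  exact: leq_trans le_M (leq_maxr _ _).
(* A generator has first coordinate of degree below [M]; its coefficient in degree [n] is killed
   modulo [t] by [a_fun pi n.+1], and [n + 1] divides [M!] for [n < M]. *)
exists (M`!)%N; split; first exact: fact_gt0.
have key f : rspan (size t).+1 (fun g => List.In g rs) f ->
    forall n, kgen t (a_fun pi (M`!)%N * dcoef (f 0%N) n).
  elim=> {f} [f fP||f g f' _ IHg _ IHf|f g E _ IH] n.
  - case: (ltnP n M) => [lt_nM|le_M]; last first.
      rewrite dcoef_small ?mulr0; first exact: gen_mod0.
      exact: leq_trans (Mr _ fP) le_M.
    have [|c ->] := @a_fun_dvd _ pi n.+1 _ (fact_gt0 M); first exact: dvdn_fact.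
    rewrite -mulrA; apply: gen_modM; apply/gen_modP.
    exists (fun i => - dcoef (f i.+1) n.+1).
    have /(congr1 (fun p => dcoef p n.+1)) := rs0 f fP.
    rewrite lin_cons dcoefD dcoef0 dcoef_lin_const dmulE dcoefM_mon /= subSS subn0.
    rewrite mulr1 Ccoef1 // => /eqP; rewrite addr_eq0 mulrC => /eqP ->.
    by rewrite /lin -sumrN; apply: eq_bigr => i _; rewrite mulNr.
  - by rewrite dcoef0 mulr0; apply: gen_mod0.
  - rewrite dcoefD dmulE dcoefM mulrDr mulr_sumr.
    apply: gen_modD (IHf n); apply: gen_mod_sum => m _.
    rewrite [X in gen_mod _ _ _ X](_ : _ = dcoef f (n - m) * Ccoef pi n m *
      (a_fun pi (M`!)%N * dcoef (g 0%N) m)); last by ring.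
    exact/gen_modM/IHg.
  - by rewrite -E.
move=> x m m1 /gen_modP[e Ee].
(* Since [x^[m-1] x^[1] = a(m) x^[m]], writing [a(m) x] as a combination of [t] with coefficients
   [e] gives a relation whose first coordinate is [x] times [x^[m-1]]. *)
pose f i := if i is j.+1 then dmon pi (- e j) m else dmon pi x m.-1.
have := key f; rewrite /f => /(_ _ m.-1); rewrite dcoef_mon eqxx mulr1n; apply.
have := rsP f; rewrite size_dmons /= size_map; apply.
rewrite lin_cons -/(dconst pi t) dmonM addn1 prednK // mulr1 Ccoef1 //.
apply: dcoefP => n; rewrite dcoef0 dcoefD dcoef_lin_const dcoef_mon mulrC Ee.
rewrite /lin -sumrMnl -big_split big1 // => i _ /=.
by rewrite dcoef_mon mulrnAl mulNr mulNrn addrN.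
Qed.


(** The preimage in [D] of a finitely generated ideal of the quotient is generated by the lifted
    generators and the constants [t]; its relations over [D] descend to the quotient. *)
Lemma quotient_coherent (A : k -> Prop) t : (forall x, A x <-> kgen t x) ->
  D_graded_coherent pi (ext_ideal pi A).
Proof.
move=> At I homI [s Is]; exists s; split=> //.
have IsP (x : D) : I x <-> gen_mod *%R (@is_zero D) ((s : seq D) ++ dconst pi t) x.
  rewrite Is; exact: (@gen_mod_quotient D (ext_ideal pi A) (dconst pi t) (ext_idealP pi At) s x).
apply: (@fg_syz_quotient D (ext_ideal pi A) (dconst pi t) (ext_idealP pi At)).
apply/fg_relP/(fg_rel_fp IsP); apply: coh homI _.
by exists ((s : seq D) ++ dconst pi t).
Qed.

End Necessity.

(** * Chains of nonunits *)

Section LocalChain.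
Variables (k : comNzRingType) (pi : nat -> k).
Hypothesis adm : admissible pi.

(* A finite substitute for localizing at a maximal ideal containing [U]: [S] is
   a multiplicative set disjoint from [U], and [Q] marks the [pi_j] that stay
   nonunits once [S] is inverted. *)
Lemma local_chain (U : k -> Prop) B :
  (forall x y, U x -> U y -> U (x + y)) -> (forall a x, U x -> U (a * x)) -> ~ U 1 ->
  exists (S : k -> Prop) (Q : nat -> bool),
    [/\ S 1 /\ (forall x y, S x -> S y -> S (x * y)),
        forall x, S x -> ~ U x,
        forall j, (2 <= j <= B)%N -> ~~ Q j -> S (pi j)
      & forall i j, (2 <= i <= B)%N -> (2 <= j <= B)%N -> Q i -> Q j ->
          (i %| j)%N \/ (j %| i)%N].
Proof.
move=> UD UM U1.
have [S [Q [S1 SM dis SQ UQ]]] : exists (S : k -> Prop) (Q : nat -> bool),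
  [/\ S 1, (forall x y, S x -> S y -> S (x * y)), forall x, S x -> ~ U x,
      forall j, (j < B.+1)%N -> ~~ Q j -> S (pi j)
    & forall j, (j < B.+1)%N -> Q j -> exists s e, S s /\ U (s * pi j ^+ e)].
  elim: B.+1 => [|b [S [Q [S1 SM dis SQ UQ]]]].
    by exists (fun x => x = 1), (fun _ => false); split=> // [x y -> ->|x ->] //; rewrite mulr1.
  (* Indices are treated one at a time: if some [s * pi b ^+ e] lies in [U], the index [b] is
     marked; otherwise the powers of [pi b] are adjoined to [S], which stays disjoint from [U]. *)
  case: (classic (exists s e, S s /\ U (s * pi b ^+ e))) => [UB|nUB].
    exists S, (fun j => Q j || (j == b)); split=> // j.
      rewrite ltnS leq_eqVlt negb_or => /orP[/eqP -> |lt_j /andP[nQ _]].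
        by rewrite eqxx andbF.
      exact: SQ.
    rewrite ltnS leq_eqVlt => /orP[/eqP -> _ //|lt_j /orP[Qj|/eqP -> //]].
    exact: UQ.
  exists (fun x => exists s e, S s /\ x = s * pi b ^+ e), (fun j => Q j && (j != b)).
  have inc s : S s -> exists s' e, S s' /\ s = s' * pi b ^+ e.
    by move=> Ss; exists s, 0%N; rewrite mulr1.
  split.
  - exact: inc.
  - move=> x y [s [e [Ss ->]]] [s' [e' [Ss' ->]]].
    by exists (s * s'), (e + e')%N; split; [apply: SM | rewrite exprD; ring].
  - by move=> x [s [e [Ss ->]]] Ux; apply: nUB; exists s, e.
  - move=> j; rewrite ltnS leq_eqVlt => /orP[/eqP -> _|lt_j].
      by exists 1, 1%N; rewrite mul1r.
    rewrite negb_and negbK => /orP[nQ|/eqP ->]; first exact/inc/SQ.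
    by exists 1, 1%N; rewrite mul1r.
  - move=> j; rewrite ltnS leq_eqVlt => /orP[/eqP ->|lt_j /andP[Qj _]].
      by rewrite eqxx andbF.
    have [s [e [Ss Us]]] := UQ j lt_j Qj; exists s, e; split=> //; exact: inc.
exists S, Q; split=> // [j /andP[_ le_jB]|i j /andP[i2 le_iB] /andP[j2 le_jB] Qi Qj].
  exact: SQ.
(* Were [pi i] and [pi j] comaximal, so would be their powers [e] and [e'], and then [s * s'] would
   lie in both [S] and [U]. *)
apply: NNPP => inc; apply: inc; apply: adm; try exact: ltnW.
rewrite !pv_ge2 // => co.
have [s [e [Ss Us]]] := UQ i le_iB Qi; have [s' [e' [Ss' Us']]] := UQ j le_jB Qj.
have [u [v E]] : comax (pi i ^+ e) (pi j ^+ e').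
  exact/comaxC/comax_exp/comaxC/comax_exp.
apply: (dis (s * s')); first exact: SM.
have -> : s * s' = (u * s') * (s * pi i ^+ e) + (v * s) * (s' * pi j ^+ e').
  transitivity (s * s' * (u * pi i ^+ e + v * pi j ^+ e')); first by rewrite E mulr1.
  by ring.
by apply: UD; apply: UM.
Qed.

End LocalChain.

(** * Structure constants along a divisibility chain *)

Section Chain.
Variables (k : comNzRingType) (pi : nat -> k) (Q : nat -> bool) (B : nat).

(** Setting the other values to 1 splits each structure constant into a part supported on the chain
    and a part invertible after localization. *)
Definition chain_part j : k := if Q j then pi j else 1.
Definition unit_part j : k := if Q j then 1 else pi j.

Lemma pv_split j : pv pi j = pv unit_part j * pv chain_part j.
Proof.
rewrite /pv /unit_part /chain_part.
by case: leqP => _; case: (Q j); rewrite ?mul1r ?mulr1 ?mul0r.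
Qed.

Lemma pv_chain_part j : (2 <= j)%N -> ~~ Q j -> pv chain_part j = 1.
Proof. by move=> j2 nQ; rewrite pv_ge2 // /chain_part (negPf nQ). Qed.

Lemma arel_split j q : (0 < j)%N -> (0 < q)%N ->
  arel pi j q = arel unit_part j q * arel chain_part j q.
Proof.
by move=> j0 q0; rewrite /arel -big_split; apply: eq_bigr => m _; apply: pv_split.
Qed.

Hypothesis chain : forall i j, (2 <= i <= B)%N -> (2 <= j <= B)%N -> Q i -> Q j ->
  (i %| j)%N \/ (j %| i)%N.

Variables (d j0 : nat).
Local Notation top := (d.*2.+1).
Hypothesis j0_gt0 : (0 < j0)%N.
Hypothesis j0_le : (j0 <= top)%N.
Hypothesis low_dvd : forall j, (2 <= j <= top)%N -> Q j -> (j %| j0)%N.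
Hypothesis high_dvd : forall j, (top < j <= B)%N -> Q j -> (j0 %| j)%N.

Local Notation Cc := (Ccoef chain_part).
Definition high j := (top < j)%N && Q j.
Definition low n a : k := \prod_(2 <= j < top.+1) pv chain_part j ^+ (n %% j < a %% j)%N.
(** For [q = j0 * q'] this is [arel chain_part j0 q'], the link between structure constants and
    torsion. *)
Definition highprod q : k := \prod_(m <- divisors q | ~~ (m %| j0)%N) pv chain_part m.

Lemma high_top j : high j -> (top < j)%N.
Proof. by case/andP. Qed.

Lemma le_d_top : (d <= top)%N.
Proof. by rewrite -addnn -addnS leq_addr. Qed.

Lemma high_lt j : high j -> (d < j)%N.
Proof. by move/high_top; apply: leq_ltn_trans le_d_top. Qed.

Lemma high_comparable i j : (i <= B)%N -> (j <= B)%N -> high i -> high j ->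
  (i %| j)%N \/ (j %| i)%N.
Proof.
by move=> iB jB /andP[ti Qi] /andP[tj Qj]; apply: chain => //;
  rewrite ?iB ?jB andbT; apply: leq_trans (_ : top < _)%N.
Qed.

Lemma high_j0 j : (j <= B)%N -> high j -> (j0 %| j)%N.
Proof. by move=> jB /andP[tj Qj]; apply: high_dvd; rewrite ?tj. Qed.

(** As a proper multiple of [j0], [j] is at least [2 j0]; it also exceeds [2 d + 1]. Averaging the
    two bounds gives the claim, and this is why the threshold is about twice [d]. *)
Lemma high_big j : (j <= B)%N -> high j -> (d + j0 <= j)%N.
Proof.
move=> jB hj; have /dvdnP[q Eq] := high_j0 jB hj.
have tj := high_top hj.
case: q Eq => [|[|q]] Eq; first by move: tj; rewrite Eq.
  by move: tj; rewrite Eq mul1n ltnNge j0_le.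
have : (j0 * 2 <= j)%N by rewrite Eq mulnC leq_pmul2r.
by move: tj; rewrite -addnn; clear - j0_le; lia.
Qed.

Lemma low_mod n n' a : n = n' %[mod j0] -> low n a = low n' a.
Proof.
move=> E; rewrite /low; apply: eq_big_seq => j; rewrite mem_index_iota => /andP[j2 jt].
case: (boolP (Q j)) => [Qj|nQ]; last by rewrite pv_chain_part // !expr1n.
have dj : (j %| j0)%N by apply: low_dvd; rewrite // j2.
by rewrite -(modn_dvdm n dj) E modn_dvdm.
Qed.

Lemma chain_coef_one n m :
  (forall j, Q j -> (2 <= j)%N -> (j <= n)%N -> eps j (n - m) m = 0%N) -> Cc n m = 1.
Proof.
move=> H; rewrite /Ccoef big1_seq // => j; rewrite mem_index_iota ltnS => /and3P[_ j2 jn].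
case: (boolP (Q j)) => [Qj|nQ]; first by rewrite H.
by rewrite pv_chain_part ?expr1n.
Qed.

(** By [eps_carry] the exponents are comparisons of residues; for [j] above [2 d + 1] the residue of
    [a] is [a] itself. *)
Lemma chain_coef_split n a : (a <= n)%N -> (a <= d)%N ->
  Cc n a = low n a * \prod_(top.+1 <= j < n.+1) pv chain_part j ^+ (n %% j < a)%N.
Proof.
move=> le_an le_ad.
rewrite (Ccoef_widen _ (b := n + top)) ?leq_addr //.
rewrite (@big_cat_nat _ _ _ top.+1) //=; last by rewrite ltnS leq_addl.
congr (_ * _).
  apply: eq_big_nat => j /andP[j2 _]; rewrite eps_carry //; exact: ltnW.
case: (leqP top n) => [le_tn | lt_nt].
  rewrite (@big_cat_nat _ _ _ n.+1) //=; last by rewrite ltnS leq_addr.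
  rewrite [X in _ * X]big1_seq ?mulr1.
    apply: eq_big_nat => j /andP[tj _]; rewrite eps_carry //; last first.
      by apply: leq_trans tj.
    by rewrite (modn_small (m := a)) //; apply: leq_ltn_trans (leq_trans le_ad le_d_top) tj.
  move=> j; rewrite mem_index_iota => /and3P[_ nj _].
  by rewrite eps_small // subnK.
rewrite [RHS]big_geq; last exact: ltnW.
rewrite big1_seq // => j; rewrite mem_index_iota => /and3P[_ tj _].
by rewrite eps_small // subnK //; apply: ltn_trans tj.
Qed.

Lemma chain_coef_low n a : (a <= n)%N -> (a <= d)%N ->
  (forall j, high j -> (j <= n)%N -> (a <= n %% j)%N) -> Cc n a = low n a.
Proof.
move=> le_an le_ad H; rewrite chain_coef_split // [X in _ * X]big1_seq ?mulr1 //.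
move=> j; rewrite mem_index_iota ltnS => /and3P[_ tj jn].
case: (boolP (Q j)) => [Qj|nQ].
  by rewrite ltnNge H //; apply/andP.
by rewrite pv_chain_part ?expr1n //; apply: leq_trans tj.
Qed.

(** Chain elements up to [2 d + 1] divide [j0] and larger ones cannot, so for them not dividing [j0]
    means being high. *)
Lemma highprodE q : (0 < q <= B)%N ->
  highprod q = \prod_(m <- divisors q | high m) pi m.
Proof.
case/andP=> q0 qB; rewrite /highprod big_seq_cond [RHS]big_seq_cond.
rewrite (bigID Q) /= [X in _ * X]big1 ?mulr1 => [|m /andP[/andP[]]].
  apply: eq_big => m.
    rewrite -andbA; apply: andb_id2l; rewrite -dvdn_divisors // => mq.
    rewrite /high andbC [RHS]andbC; apply: andb_id2l => Qm.
    have [m0 mB] : (0 < m)%N /\ (m <= B)%N.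
      by split; [apply: dvdn_gt0 mq | apply: leq_trans qB; apply: dvdn_leq].
    case: (leqP m top) => [mt|tm].
      case: (ltnP 1 m) => [m2|]; first by rewrite low_dvd // m2.
      by case: m m0 {mq Qm mB mt} => [|[|]] //; rewrite dvd1n.
    apply/negP => /(dvdn_leq j0_gt0) => mj.
    by have := leq_trans tm mj; rewrite ltnNge j0_le.
  case/andP=> /andP[mq nj] Qm; rewrite pv_ge2 ?/chain_part ?Qm //.
  have : (0 < m)%N by apply: (@dvdn_gt0 _ q); rewrite // dvdn_divisors.
  by case: m nj {mq Qm} => [|[|]] //; rewrite ?dvd1n.
rewrite -dvdn_divisors // => mq nj nQ; rewrite pv_chain_part //.
have : (0 < m)%N by apply: dvdn_gt0 mq.
by case: m nj {mq nQ} => [|[|]] //; rewrite dvd1n.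
Qed.

Lemma highprod_ext q q' : (0 < q <= B)%N -> (0 < q' <= B)%N ->
  (forall m, high m -> (m <= B)%N -> (m %| q)%N = (m %| q')%N) ->
  highprod q = highprod q'.
Proof.
move=> qB q'B E; rewrite !highprodE //.
case/andP: qB => q0 qB; case/andP: q'B => q'0 q'B.
rewrite -[LHS]big_filter -[RHS]big_filter; apply: perm_big.
apply: uniq_perm; rewrite ?filter_uniq ?divisors_uniq // => m.
rewrite !mem_filter -!dvdn_divisors //; apply: andb_id2l => hm.
case: (leqP m B) => [/(E _ hm) //|Bm].
by rewrite !gtnNdvd //; apply: leq_ltn_trans Bm.
Qed.

Lemma highprod_j0 : highprod j0 = 1.
Proof. by rewrite /highprod big1_seq // => m; rewrite -dvdn_divisors // => /andP[/negP]. Qed.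

(** * Degrees with a small residue modulo a large chain element *)

Section Residue.
Variables (n j1 rho : nat).
Hypotheses (nB : (n <= B)%N) (hj1 : high j1) (j1n : (j1 <= n)%N).
Hypotheses (En : (n %% j1)%N = rho) (rho_d : (rho < d)%N).

Lemma residue_dvd : (j1 %| n - rho)%N.
Proof. by rewrite -En {1}(divn_eq n j1) addnK dvdn_mull. Qed.

Lemma residue_le : (rho <= n)%N.
Proof. by rewrite -En leq_mod. Qed.

(** Of the comparable [j1] and [j], reduce modulo the one dividing the other: residues below [d] are
    below both, hence unchanged, hence equal. *)
Lemma residue_mod j : high j -> (j <= n)%N -> (n %% j < d)%N -> (n %% j)%N = rho.
Proof.
move=> hj jn lt_d.
have [] := high_comparable (leq_trans j1n nB) (leq_trans jn nB) hj1 hj => dv.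
  rewrite -En -(modn_dvdm n dv) [RHS]modn_small //.
  exact: ltn_trans lt_d (high_lt hj1).
rewrite -(modn_dvdm n dv) En modn_small //.
exact: ltn_trans rho_d (high_lt hj).
Qed.

Lemma residue_j0 : (n = rho %[mod j0])%N.
Proof.
have := dvdn_trans (high_j0 (leq_trans j1n nB) hj1) residue_dvd.
by rewrite -eqn_mod_dvd ?residue_le // => /eqP.
Qed.

Lemma residue_dvdE j : high j -> (j <= n)%N -> (j %| n - rho)%N = (n %% j < d)%N.
Proof.
move=> hj jn; apply/idP/idP => [|lt_d].
  rewrite -eqn_mod_dvd ?residue_le // => /eqP ->.
  by apply: leq_ltn_trans (leq_mod _ _) rho_d.
by rewrite -eqn_mod_dvd ?residue_le // -(residue_mod hj jn lt_d) modn_mod.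
Qed.

(** No high element carries, since its residue is either [rho >= a] or at least [d > a]. *)
Lemma chain_coef_residue_low a : (a <= rho)%N -> Cc n a = low rho a.
Proof.
move=> ar; rewrite chain_coef_low ?(low_mod a residue_j0) //.
- exact: leq_trans ar residue_le.
- by apply: ltnW; apply: leq_ltn_trans ar rho_d.
move=> j hj jn; case: (ltnP (n %% j)%N d) => [lt_d|le_d].
  by rewrite (residue_mod hj).
by apply: leq_trans le_d; apply: leq_trans ar (ltnW rho_d).
Qed.

(** A high element carries exactly when its residue is [rho], that is, when it divides [n - rho]. *)
Lemma chain_coef_residue_high a : (rho < a)%N -> (a <= d)%N ->
  Cc n a = low n a * highprod (n - rho).
Proof.
move=> ra ad; have an : (a <= n)%N.
  by apply: leq_trans j1n; apply: leq_trans ad (ltnW (high_lt hj1)).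
rewrite chain_coef_split //; congr (_ * _).
have nr0 : (0 < n - rho)%N by rewrite subn_gt0; apply: leq_trans an.
transitivity (\prod_(top.+1 <= j < n.+1 | (j %| n - rho)%N && Q j) pv chain_part j).
  rewrite [RHS]big_mkcond; apply: eq_big_nat => j /andP[tj jn].
  case: (boolP (Q j)) => [Qj|nQ].
    have hj : high j by apply/andP.
    rewrite andbT residue_dvdE //.
    case: (ltnP (n %% j)%N d) => [lt_d|le_d].
      by rewrite (residue_mod hj) // ra.
    by rewrite ltnNge (leq_trans ad).
  by rewrite andbF pv_chain_part ?expr1n //; apply: leq_trans tj.
rewrite highprodE; last by rewrite nr0 (leq_trans (leq_subr _ _)).
rewrite -[LHS]big_filter -[RHS]big_filter.
transitivity (\prod_(j <- [seq j <- index_iota top.+1 n.+1 | (j %| n - rho)%N && Q j]) pi j).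
  apply: eq_big_seq => j; rewrite mem_filter mem_index_iota.
  case/andP=> /andP[_ Qj] /andP[tj _]; rewrite pv_ge2 ?/chain_part ?Qj //.
  exact: leq_trans tj.
apply: perm_big; apply: uniq_perm; rewrite ?filter_uniq ?iota_uniq ?divisors_uniq //.
move=> j; rewrite !mem_filter mem_index_iota -dvdn_divisors // /high.
case dv: (j %| n - rho)%N; rewrite ?andbF //= andbT andbC.
have -> : (j < n.+1)%N by rewrite ltnS; apply: leq_trans (dvdn_leq nr0 dv) (leq_subr _ _).
by rewrite andbT.
Qed.

(** Relations in degree [rho] move to degree [n] without a new chain factor: each chain element
    divides [n - rho] or is a multiple of [j1], which divides [n - rho] and exceeds [rho - a], so
    nothing carries. *)
Lemma chain_coef_residue_shift a : (a <= rho)%N -> Cc (n - a) (rho - a) = 1.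
Proof.
move=> ar; have Ex : (n - a - (rho - a) = n - rho)%N.
  by have := residue_le; clear - ar; lia.
apply: chain_coef_one => j Qj j2 jn; rewrite Ex.
have {}jn : (j <= n)%N by apply: leq_trans jn (leq_subr _ _).
case: (leqP j top) => [jt|tj].
  apply: eps_dvd; apply: dvdn_trans (low_dvd _ Qj) _; first by rewrite j2.
  exact: dvdn_trans (high_j0 (leq_trans j1n nB) hj1) residue_dvd.
have hj : high j by apply/andP.
case: (high_comparable (leq_trans j1n nB) (leq_trans jn nB) hj1 hj) => dv.
  apply: (eps_nocarry residue_dvd) dv.
  apply: leq_ltn_trans (leq_subr _ _) _.
  exact: ltn_trans rho_d (high_lt hj1).
exact: eps_dvd (dvdn_trans dv residue_dvd).
Qed.

(** As for [chain_coef_residue_shift], with [e] in place of [j1]: [e] divides [n - rho - e], and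
    [rho + e - a < e]. *)
Lemma chain_coef_pivot_shift e a : high e -> (e %| n - rho)%N -> (rho < a)%N ->
  (a <= d)%N -> Cc (n - a) (rho + e - a) = 1.
Proof.
move=> he de ra ad.
have de_lt := high_lt he.
have an : (a <= n)%N.
  by apply: leq_trans j1n; apply: leq_trans ad (ltnW (high_lt hj1)).
have en : (rho + e <= n)%N.
  have rn := leq_trans ra an; rewrite -leq_subRL; last exact: ltnW.
  by apply: dvdn_leq de; rewrite subn_gt0.
have Ex : (n - a - (rho + e - a) = n - rho - e)%N.
  by clear - de_lt ra ad an; lia.
have dx : (e %| n - rho - e)%N by rewrite dvdn_sub.
apply: chain_coef_one => j Qj j2 jn; rewrite Ex.
have {}jn : (j <= n)%N by apply: leq_trans jn (leq_subr _ _).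
have eB : (e <= B)%N by apply: leq_trans nB; apply: leq_trans en; apply: leq_addl.
case: (leqP j top) => [jt|tj].
  apply: eps_dvd; apply: dvdn_trans (low_dvd _ Qj) _; first by rewrite j2.
  exact: dvdn_trans (high_j0 eB he) dx.
have hj : high j by apply/andP.
case: (high_comparable eB (leq_trans jn nB) he hj) => dv.
  by apply: (eps_nocarry dx) dv; clear - de_lt ra ad; lia.
exact: eps_dvd (dvdn_trans dv dx).
Qed.

End Residue.

(** [e] is the largest common high divisor, or [j0] if there is none. If some high [m0] divides [q]
    but not [q'], comparability makes every high divisor of [q'] divide [m0], hence [q]. So the high
    divisors of [e] are all those of [q] or all those of [q']. *)
Lemma pivot q q' : (0 < q <= B)%N -> (0 < q' <= B)%N -> (j0 %| q)%N -> (j0 %| q')%N ->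
  exists e, [/\ e = j0 \/ high e, (e %| q)%N, (e %| q')%N
    & highprod e = highprod q \/ highprod e = highprod q'].
Proof.
move=> qB q'B dq dq'; case/andP: (qB) => q0 leqB; case/andP: (q'B) => q'0 leq'B.
pose P m := [&& high m, (m %| q)%N & (m %| q')%N].
have [e [e_high eq eq' eP]] : exists e, [/\ e = j0 \/ high e, (e %| q)%N, (e %| q')%N
    & forall m, P m -> (m %| e)%N].
  case: (classic (exists m, P m)) => [exP|nP]; last first.
    by exists j0; split=> //; [left | move=> m Pm; case: nP; exists m].
  have ubP m : P m -> (m <= q)%N by case/and3P=> _ /(dvdn_leq q0).
  case: (ex_maxnP exP ubP) => e Pe maxe; have /and3P[he deq deq'] := Pe.
  exists e; split=> // [|m Pm]; first by right.
  have /and3P[hm _ _] := Pm.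
  have [] := high_comparable (leq_trans (ubP _ Pm) leqB) (leq_trans (ubP _ Pe) leqB) hm he => // em.
  have m0 : (0 < m)%N by apply: leq_trans (high_top hm).
  have := dvdn_leq m0 em; have := maxe m Pm; move=> H1 H2.
  by have /eqP -> : m == e by rewrite eqn_leq H1.
have eB : (0 < e <= B)%N.
  by rewrite (dvdn_gt0 q0 eq) (leq_trans _ leqB) // dvdn_leq.
exists e; split=> //.
have ediv m : high m -> (m %| e)%N = (m %| q)%N && (m %| q')%N.
  move=> hm; apply/idP/andP => [me|[mq mq']]; last by apply: eP; apply/and3P.
  by split; apply: dvdn_trans me _.
case: (classic (exists m, [/\ high m, (m <= B)%N, (m %| q)%N & ~~ (m %| q')%N])).
  case=> m0 [h0 m0B m0q m0q']; right; apply: highprod_ext => // m hm mB.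
  rewrite ediv //; case mq': (m %| q')%N; rewrite ?andbF ?andbT //.
  have [dv|dv] := high_comparable m0B mB h0 hm; last exact: dvdn_trans dv m0q.
  by case/negP: m0q'; apply: dvdn_trans dv mq'.
move=> nex; left; apply: highprod_ext => // m hm mB; rewrite ediv //.
case mq: (m %| q)%N => //=; apply: NNPP => /negP nq'; apply: nex.
by exists m.
Qed.

(** For [d <= n], the least degree that is at least [d] and congruent to [n] modulo [j0]. *)
Definition base_degree n := (d + (n - d) %% j0)%N.

Lemma base_degree_lt n : (base_degree n < d + j0)%N.
Proof. by rewrite ltn_add2l ltn_pmod. Qed.

Lemma base_degree_le n : (d <= n)%N -> (base_degree n <= n)%N.
Proof. by move=> dn; rewrite -{2}(subnKC dn) leq_add2l leq_mod. Qed.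

Lemma base_degree_mod n : (d <= n)%N -> (base_degree n = n %[mod j0])%N.
Proof. by move=> dn; rewrite /base_degree modnDmr subnKC. Qed.

(** The base degree is below [d + j0], so no high element reaches it, and the low part depends only
    on the class modulo [j0]. *)
Lemma chain_coef_base n a : (d <= n)%N -> (a <= d)%N -> (n <= B)%N ->
  Cc (base_degree n) a = low n a.
Proof.
move=> dn ad nB; rewrite chain_coef_low ?(low_mod a (base_degree_mod dn)) //.
  exact: leq_trans ad (leq_addr _ _).
move=> j hj jb; have := leq_trans jb (base_degree_le dn) => jn.
have := high_big (leq_trans jn nB) hj; have := base_degree_lt n; lia.
Qed.

Lemma chain_coef_base_shift n a : (d <= n)%N -> (a <= d)%N -> (n <= B)%N ->
  (forall j, high j -> (j <= n)%N -> (d <= n %% j)%N \/ (n %% j < a)%N) ->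
  Cc (n - a) (base_degree n - a) = 1.
Proof.
move=> dn ad nB H; have bn := base_degree_le dn.
have ab : (a <= base_degree n)%N by apply: leq_trans ad (leq_addr _ _).
have Ex : (n - a - (base_degree n - a) = n - base_degree n)%N by lia.
apply: chain_coef_one => j Qj j2 jna; rewrite Ex.
have jn : (j <= n)%N by apply: leq_trans jna (leq_subr _ _).
case: (leqP j top) => [jt|tj].
  apply: eps_dvd; apply: dvdn_trans (low_dvd _ Qj) _; first by rewrite j2.
  by rewrite -eqn_mod_dvd // base_degree_mod.
have hj : high j by apply/andP.
have j_big := high_big (leq_trans jn nB) hj; have blt := base_degree_lt n.
have jpos : (0 < j)%N by apply: ltnW.
rewrite -Ex eps_carry //; last exact: leq_sub2r.
rewrite [X in (_ < X)%N]modn_small; last by lia.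
(* If [n %% j >= d], minimality in the class modulo [j0] gives [base_degree n <= n %% j], and
   subtracting [a] needs no borrow. *)
case: (H j hj jn) => [le_d|lt_a].
  have le_b : (base_degree n <= n %% j)%N.
    rewrite /base_degree -[leqRHS](subnKC le_d) leq_add2l.
    suff -> : ((n - d) %% j0 = (n %% j - d) %% j0)%N by apply: leq_mod.
    apply/eqP; rewrite -(eqn_modDr d) !subnK // modn_dvdm //.
    by apply: high_j0 => //; apply: leq_trans nB.
  rewrite {1}(divn_eq n j) -addnBA; last by lia.
  rewrite modnMDl modn_small; first by rewrite ltnNge leq_sub2r.
  by apply: leq_ltn_trans (leq_subr _ _) _; rewrite ltn_pmod.
(* Here the subtraction of [a] borrows [j], which exceeds the base degree. *)
have q1 : (0 < n %/ j)%N by rewrite divn_gt0.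
have -> : (n - a = (n %/ j).-1 * j + (j + n %% j - a))%N.
  rewrite {1}(divn_eq n j) -{1}(prednK q1) mulSn; lia.
rewrite modnMDl modn_small; last by lia.
rewrite ltnNge; suff -> : (base_degree n - a <= j + n %% j - a)%N by [].
by rewrite leq_sub2r //; apply: leq_trans (leq_addr _ _); lia.
Qed.

End Chain.

(** The largest chain element up to [2 d + 1], counting 1 as one, works: comparability turns order
    into divisibility. *)
Lemma low_top_exists (Q : nat -> bool) B d :
  (forall i j, (2 <= i <= B)%N -> (2 <= j <= B)%N -> Q i -> Q j ->
    (i %| j)%N \/ (j %| i)%N) -> (d.*2.+1 <= B)%N ->
  exists j0, [/\ (0 < j0)%N, (j0 <= d.*2.+1)%N,
    forall j, (2 <= j <= d.*2.+1)%N -> Q j -> (j %| j0)%N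
  & forall j, (d.*2.+1 < j <= B)%N -> Q j -> (j0 %| j)%N].
Proof.
move=> chain; set top := d.*2.+1 => tB.
pose P j := [&& (0 < j)%N, (j <= top)%N & (j == 1%N) || Q j].
have exP : exists j, P j by exists 1%N.
have ubP j : P j -> (j <= top)%N by case/and3P.
case: (ex_maxnP exP ubP) => j0 /and3P[j0_gt0 j0_le j0Q] maxj.
exists j0; split=> // j /andP[j2 jt] Qj.
  have Pj : P j by rewrite /P Qj orbT jt /= andbT; apply: ltnW.
  have jj0 := maxj j Pj.
  case: (eqVneq j0 1%N) j0Q => [E|n1] /= Qj0; first by move: jj0; rewrite E leqNgt j2.
  have j02 : (2 <= j0)%N by rewrite ltn_neqAle eq_sym n1.
  case: (chain j j0); rewrite ?j2 ?j02 ?(leq_trans _ tB) // => dv.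
  have := dvdn_leq (ltnW j2) dv => H.
  by have /eqP -> : j == j0 by rewrite eqn_leq jj0.
case: (eqVneq j0 1%N) j0Q => [E|n1] /= Qj0; first by rewrite E dvd1n.
have j02 : (2 <= j0)%N by rewrite ltn_neqAle eq_sym n1.
have j_2 : (2 <= j)%N by apply: leq_trans j2.
case: (chain j0 j); rewrite ?j02 ?j_2 ?(leq_trans j0_le) // => dv.
by have := dvdn_leq j0_gt0 dv; have := leq_trans j2 (leqnn j); lia.
Qed.

(** * Relations in a fixed degree *)

Section Relations.
Variables (k : comNzRingType) (pi : nat -> k) (cs : seq (k * nat)) (bound : nat).
Local Notation D := (gdpa pi).
Local Notation s := (size cs).
Local Notation c := (cst cs).
Local Notation a := (deg cs).
Implicit Types b beta : nat -> k.

(** The product of [x^[n - a i]] and the [i]-th generator is [weight n i] times [x^[n]]. *)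
Definition weight n i : k := if (a i <= n)%N then Ccoef pi n (a i) * c i else 0.
Definition syz n b := \sum_(i < s) b i * weight n i = 0.
Definition embed n b : nat -> D :=
  fun i => if (a i <= n)%N then dmon pi (b i) (n - a i) else 0.
Definition low_rel (g : nat -> D) :=
  exists m b, [/\ (m <= bound)%N, syz m b & g = embed m b].
Definition generated n b := rspan s low_rel (embed n b).

Lemma generated_ext n b b' :
  (forall i, (i < s)%N -> (a i <= n)%N -> b i = b' i) -> generated n b -> generated n b'.
Proof.
move=> E; apply: rspan_ext => i lt_i; rewrite /embed.
by case: ifP => // le_a; rewrite E.
Qed.

Lemma embed_lin x n b b' i :
  embed n (fun i => x * b i + b' i) i = dmon pi x 0 * embed n b i + embed n b' i.
Proof.
rewrite /embed; case: ifP => _; last by rewrite mulr0 addr0.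
by rewrite dmonM add0n Ccoef_id mulr1 dmonD.
Qed.

Lemma generated_lin x n b b' : generated n b -> generated n b' ->
  generated n (fun i => x * b i + b' i).
Proof.
move=> gb gb'; apply: rspan_ext (rspan_lin (dmon pi x 0) gb gb') => i _.
by rewrite embed_lin.
Qed.

Lemma generated0 n : generated n (fun _ => 0).
Proof.
by apply: rspan_ext (rspan0 _ _) => i _; rewrite /embed dmon0; case: ifP.
Qed.

Lemma generatedZ x n b : generated n b -> generated n (fun i => x * b i).
Proof.
move=> gb; apply: generated_ext (generated_lin x gb (generated0 n)) => i _ _.
by rewrite addr0.
Qed.

Lemma generated_low n b : (n <= bound)%N -> syz n b -> generated n b.
Proof. by move=> nb rb; apply: rspan_gen; exists n, b. Qed.

(** Multiply by [x^[n - m]], which takes [x^[m - a i]] to the stated multiple of [x^[n - a i]]. *)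
Lemma generated_shift m n b : generated m b -> (m <= n)%N ->
  generated n (fun i => if (a i <= m)%N then b i * Ccoef pi (n - a i) (m - a i) else 0).
Proof.
move=> gb mn; apply: rspan_ext (rspanZ (dmon pi 1 (n - m)) gb) => i _.
rewrite /embed; case: (leqP (a i) m) => [am|ma].
  rewrite (leq_trans am mn) dmonM mul1r.
  by have -> : (n - m + (m - a i) = n - a i)%N by lia.
by rewrite mulr0; case: ifP; rewrite ?dmon0.
Qed.

(** * Relations after inverting [S] *)

Section Localized.
Variables (S : k -> Prop) (Q : nat -> bool) (B : nat).
Hypotheses (S1 : S 1) (SM : forall x y, S x -> S y -> S (x * y)).
Hypothesis SQ : forall j, (2 <= j <= B)%N -> ~~ Q j -> S (pi j).
Local Notation Cc := (Ccoef (chain_part pi Q)).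
Local Notation Cu := (Ccoef (unit_part pi Q)).

Lemma unit_prod (I : Type) (r : seq I) (P : pred I) (F : I -> k) :
  (forall i, P i -> S (F i)) -> S (\prod_(i <- r | P i) F i).
Proof. by move=> H; apply: big_ind. Qed.

Lemma unit_pv j : (2 <= j <= B)%N -> S (pv (unit_part pi Q) j).
Proof.
case/andP=> j2 jB; rewrite pv_ge2 // /unit_part.
by case: (boolP (Q j)) => // nQ; apply: SQ; rewrite // j2.
Qed.

Lemma unit_coef n m : (n <= B)%N -> S (Cu n m).
Proof.
move=> nB; rewrite /Ccoef big_seq_cond; apply: unit_prod => j.
rewrite mem_index_iota ltnS andbT => /andP[j2 jn].
have := unit_pv (j := j); rewrite j2 (leq_trans jn nB) => /(_ isT) Sj.
by elim: (eps _ _ _) => [|e IH]; rewrite ?expr0 // exprS; apply: SM.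
Qed.

Lemma unit_arel j q : (0 < j)%N -> (0 < q)%N -> (j * q <= B)%N ->
  S (arel (unit_part pi Q) j q).
Proof.
move=> j0 q0 jqB; rewrite /arel big_seq_cond; apply: unit_prod => m /andP[].
have jq0 : (0 < j * q)%N by rewrite muln_gt0 j0.
rewrite -dvdn_divisors // => mjq nmj; apply: unit_pv.
rewrite (leq_trans (dvdn_leq jq0 mjq) jqB) andbT.
have := dvdn_gt0 jq0 mjq.
by case: m nmj {mjq} => [|[|]] //; rewrite dvd1n.
Qed.

Definition unit_norm n : k := \prod_(l < s) Cu n (a l).
Definition cofac n i : k := \prod_(l < s | (l : nat) != i) Cu n (a l).

Lemma cofacE n i : (i < s)%N -> cofac n i * Cu n (a i) = unit_norm n.
Proof. by move=> lt_i; rewrite /unit_norm (bigD1 (Ordinal lt_i)) //= mulrC. Qed.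

Lemma unit_norm_unit n : (n <= B)%N -> S (unit_norm n).
Proof. by move=> nB; apply: unit_prod => l _; apply: unit_coef. Qed.

(* After inverting [S] and rescaling the [i]-th coordinate by the unit
   [Cu n (a i)], relations become relations for [chain_part];
   [cofac n i / unit_norm n] stands for the inverse of [Cu n (a i)]. *)
Definition chain_rel n beta :=
  \sum_(i < s) (if (a i <= n)%N then beta i * (Cc n (a i) * c i) else 0) = 0.
Definition locally n beta :=
  exists2 t, S t & generated n (fun i => t * beta i * cofac n i).

Lemma weight_split n i :
  weight n i = if (a i <= n)%N then Cu n (a i) * (Cc n (a i) * c i) else 0.
Proof.
by rewrite /weight; case: ifP => // _; rewrite (Ccoef_split _ _ (pv_split pi Q)) mulrA.
Qed.

Lemma locally_ext n beta beta' :
  (forall i, (i < s)%N -> (a i <= n)%N -> beta i = beta' i) ->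
  locally n beta -> locally n beta'.
Proof.
move=> E [t St gb]; exists t => //; apply: generated_ext gb => i lt_i le_a.
by rewrite E.
Qed.

Lemma locallyD n beta beta' : locally n beta -> locally n beta' ->
  locally n (fun i => beta i + beta' i).
Proof.
move=> [t St gb] [t' St' gb']; exists (t * t'); first exact: SM.
apply: generated_ext (generated_lin t' gb (generatedZ t gb')) => i _ _.
by ring.
Qed.

Lemma locally_unit n u beta : S u -> locally n (fun i => u * beta i) -> locally n beta.
Proof.
move=> Su [t St gb]; exists (t * u); first exact: SM.
by apply: generated_ext gb => i _ _; rewrite !mulrA.
Qed.

(** Scaling by [cofac m i] turns [beta] into a true relation, to be multiplied by [x^[n - m]]. By
    the cocycle identity for the unit part, the unit factors that remain are [Cu n m] and
    [unit_norm m], which do not depend on [i]. *)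
Lemma locally_shift m n beta : chain_rel m beta -> (m <= bound)%N -> (m <= n)%N ->
  (n <= B)%N ->
  locally n (fun i => if (a i <= m)%N then beta i * Cc (n - a i) (m - a i) else 0).
Proof.
move=> rb mb mn nB.
have rb' : syz m (fun i => beta i * cofac m i).
  rewrite /syz -[RHS](mulr0 (unit_norm m)) -[in RHS]rb mulr_sumr; apply: eq_bigr => i _.
  rewrite weight_split; case: ifP => _; last by rewrite !mulr0.
  by rewrite -(cofacE m (ltn_ord i)); ring.
have mB : (m <= B)%N by apply: leq_trans nB.
exists (unit_norm m * Cu n m); first by apply: SM; [apply: unit_norm_unit | apply: unit_coef].
have := generatedZ (unit_norm n) (generated_shift (generated_low mb rb') mn).
apply: generated_ext => i lt_i le_a; case: (leqP (a i) m) => [am|_]; last first.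
  by rewrite !mulr0 mul0r.
rewrite -(cofacE n lt_i) -(cofacE m lt_i) (Ccoef_split _ _ (pv_split pi Q)).
have := Ccoef_cocycle (unit_part pi Q) (n - m) (m - a i) (a i).
rewrite (_ : n - m + (m - a i) = n - a i)%N; last by lia.
rewrite subnK ?(leq_trans am) // subnK // => E.
transitivity (Cu (n - a i) (m - a i) * Cu n (a i) *
  (cofac n i * beta i * cofac m i * Cc (n - a i) (m - a i))); first by ring.
by rewrite E; ring.
Qed.

Lemma chain_rel_shift m n beta : chain_rel m beta -> (m <= n)%N ->
  chain_rel n (fun i => if (a i <= m)%N then beta i * Cc (n - a i) (m - a i) else 0).
Proof.
move=> rb mn; rewrite /chain_rel -[RHS](mulr0 (Cc n m)) -[in RHS]rb mulr_sumr.
apply: eq_bigr => i _; case: (leqP (a i) m) => [am|_]; last first.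
  by rewrite mulr0; case: ifP; rewrite ?mul0r.
rewrite (leq_trans am mn).
have := Ccoef_cocycle (chain_part pi Q) (n - m) (m - a i) (a i).
rewrite (_ : n - m + (m - a i) = n - a i)%N; last by lia.
rewrite subnK ?(leq_trans am) // subnK // => E.
transitivity (Cc (n - a i) (m - a i) * Cc n (a i) * (beta i * c i)); first by ring.
by rewrite E; ring.
Qed.

Lemma chain_relB n x beta beta' : chain_rel n beta -> chain_rel n beta' ->
  chain_rel n (fun i => x * beta i - beta' i).
Proof.
rewrite /chain_rel => rb rb'; have /= := congr2 (fun u v => x * u - v) rb rb'.
rewrite mulr0 subr0 mulr_sumr -sumrB => E; rewrite -[RHS]E; apply: eq_bigr => i _.
by case: ifP => _; [ring | rewrite mulr0 subr0].
Qed.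

Hypothesis chain : forall i j, (2 <= i <= B)%N -> (2 <= j <= B)%N -> Q i -> Q j ->
  (i %| j)%N \/ (j %| i)%N.
Variables d N : nat.
Local Notation top := (d.*2.+1).
Hypothesis deg_le : forall i, (a i <= d)%N.
Hypothesis N_gt0 : (0 < N)%N.
Hypothesis torsion_le : forall j rho x m, (0 < j <= top)%N -> (rho < d)%N -> (0 < m)%N ->
  kgen (mkseq (weight rho) s) (arel pi j m * x) ->
  kgen (mkseq (weight rho) s) (arel pi j N * x).
Hypothesis bound_ge : (d + top * N <= bound)%N.
Hypothesis B_ge : (top * N <= B)%N.

Lemma locally_rel n beta : (bound < n)%N -> (n <= B)%N -> chain_rel n beta ->
  locally n beta.
Proof.
move=> bn nB rb.
have topN : (top <= top * N)%N by rewrite leq_pmulr.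
have dn : (d <= n)%N by apply: leq_trans (ltnW bn); apply: leq_trans bound_ge; apply: leq_addr.
have [j0 [j0_gt0 j0_le low_dvd high_dvd]] := low_top_exists chain (leq_trans topN B_ge).
have hc := high_comparable chain.
set hi := high Q d in hc.
pose m0 := base_degree d j0 n.
have m0n : (m0 <= n)%N by apply: base_degree_le.
have m0bound : (m0 <= bound)%N.
  apply: leq_trans bound_ge; apply: ltnW; apply: leq_trans (base_degree_lt _ j0_gt0 _) _.
  by rewrite leq_add2l (leq_trans j0_le).
have base_coef i : Cc m0 (a i) = low pi Q d n (a i) 
  by apply: (chain_coef_base pi j0_gt0 j0_le low_dvd high_dvd).
(* If no high element has a residue below [d], the chain coefficients in degrees [n] and [m0] agree,
   so [beta] is a relation in degree [m0] and shifts back with constants 1. *)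
case: (classic (exists j1, [/\ hi j1, (j1 <= n)%N & (n %% j1 < d)%N])); last first.
  move=> nores.
  have res j : hi j -> (j <= n)%N -> (d <= n %% j)%N.
    by move=> hj jn; rewrite leqNgt; apply/negP => lt_d; apply: nores; exists j.
  have rb0 : chain_rel m0 beta.
    rewrite /chain_rel -[RHS]rb; apply: eq_bigr => i _.
    rewrite (leq_trans (deg_le i) (leq_addr _ _)) (leq_trans (deg_le i) dn) base_coef.
    rewrite (chain_coef_low pi (leq_trans (deg_le i) dn) (deg_le i)) // => j hj jn.
    exact: leq_trans (deg_le i) (res j hj jn).
  apply: locally_ext (locally_shift rb0 m0bound m0n nB) => i _ _.
  rewrite (leq_trans (deg_le i) (leq_addr _ _)).
  rewrite (chain_coef_base_shift pi j0_gt0 j0_le low_dvd high_dvd) ?mulr1 // => j hj jn.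
  by left; apply: res.
case=> j1 [hj1 j1n]; set rho := (n %% j1)%N => rho_d.
have En : (n %% j1)%N = rho by [].
have rho_n : (rho <= n)%N by apply: leq_mod.
have rho_mod : (n = rho %[mod j0])%N by apply: (residue_j0 high_dvd nB hj1 j1n).
pose g i := low pi Q d n (a i) * c i.
(* In the degrees used below, the high elements contribute one common factor [h] to the generators
   of degree above [rho] and none to the others, so a relation reads [X + h * V = 0]. *)
pose X (gamma : nat -> k) := \sum_(i < s | (a i <= rho)%N) gamma i * g i.
pose V (gamma : nat -> k) := \sum_(i < s | ~~ (a i <= rho)%N) gamma i * g i.
have splitE m h (gamma : nat -> k) : (d <= m)%N ->
    (forall i, (a i <= rho)%N -> Cc m (a i) = low pi Q d n (a i)) ->
    (forall i, (rho < a i)%N -> Cc m (a i) = low pi Q d n (a i) * h) ->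
    \sum_(i < s) (if (a i <= m)%N then gamma i * (Cc m (a i) * c i) else 0)
    = X gamma + h * V gamma.
  move=> dm lowE highE; rewrite (bigID (fun i : 'I_s => (a i <= rho)%N)) /= mulr_sumr.
  congr (_ + _); apply: eq_bigr => i; rewrite (leq_trans (deg_le i) dm).
    by move=> ai; rewrite lowE.
  by rewrite -ltnNge => ai; rewrite highE // /g; ring.
have lowE i : (a i <= rho)%N -> Cc n (a i) = low pi Q d n (a i).
  move=> ai; rewrite (low_mod _ low_dvd _ rho_mod).
  exact: (chain_coef_residue_low pi chain low_dvd high_dvd nB hj1 j1n En).
have highE i : (rho < a i)%N ->
    Cc n (a i) = low pi Q d n (a i) * highprod pi Q j0 (n - rho).
  move=> ai.
  exact: (chain_coef_residue_high pi chain j0_gt0 j0_le low_dvd nB hj1 j1n En).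
have rhoE i : (a i <= rho)%N -> Cc rho (a i) = low pi Q d n (a i).
  move=> ai; rewrite (low_mod _ low_dvd _ rho_mod).
  apply: (chain_coef_low pi) => // j hj; rewrite leqNgt => /negP[].
  exact: ltn_trans rho_d (high_lt hj).
have rhoB : (rho <= B)%N by apply: leq_trans nB.
(* Up to the unit [unit_norm rho], the values of [X] are the ideal generated by the weights in
   degree [rho]. *)
have XK (gamma : nat -> k) : kgen (mkseq (weight rho) s) (unit_norm rho * X gamma).
  apply/gen_modP.
  exists (fun i => if (a i <= rho)%N then gamma i * cofac rho i else 0).
  rewrite /lin size_mkseq /X mulr_sumr big_mkcond; apply: eq_bigr => i _.
  rewrite nth_mkseq // weight_split; case: ifP => ai; last by rewrite mul0r.
  by rewrite -(cofacE rho (ltn_ord i)) rhoE // /g; ring.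
have KX y : kgen (mkseq (weight rho) s) y -> exists gamma : nat -> k, y = X gamma.
  case/gen_modP=> f ->; exists (fun i => f i * Cu rho (a i)).
  rewrite /lin size_mkseq /X [RHS]big_mkcond; apply: eq_bigr => i _.
  rewrite nth_mkseq // weight_split; case: ifP => ai; last by rewrite mulr0.
  by rewrite rhoE // /g; ring.
have XV : X beta + highprod pi Q j0 (n - rho) * V beta = 0.
  by rewrite -(splitE n) // rb.
have [q0 q0_gt0 Eq0] : exists2 q0, (0 < q0)%N & (n - rho = j0 * q0)%N.
  have /dvdnP[q0 Eq0] : (j0 %| n - rho)%N by rewrite -eqn_mod_dvd // rho_mod.
  exists q0; last by rewrite mulnC.
  by move: rho_d dn (bn); case: q0 Eq0 => // Eq0 *; exfalso; move: bound_ge topN; lia.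
have j0NB : (j0 * N <= B)%N by apply: leq_trans B_ge; rewrite leq_mul2r j0_le orbT.
have j0N0 : (0 < j0 * N)%N by rewrite muln_gt0 j0_gt0.
(* The first factor completes [highprod] at [j0 * N] to [arel pi j0 N]; the second brings values of
   [X] into the ideal of weights. *)
pose t := arel (unit_part pi Q) j0 N * unit_norm rho.
have St : S t by apply: SM; [apply: unit_arel | apply: unit_norm_unit].
have [gamma0 Eg0] : exists gamma : nat -> k, t * (highprod pi Q j0 (j0 * N) * V beta) = X gamma.
  apply: KX.
  have -> : t * (highprod pi Q j0 (j0 * N) * V beta) = arel pi j0 N * (unit_norm rho * V beta).
    by rewrite (arel_split pi Q j0_gt0 N_gt0) /t /highprod /arel; ring.
  apply: (torsion_le (m := q0)); rewrite ?j0_gt0 //.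
  (* The relation itself shows that [V beta] is torsion modulo the weights in degree [rho]. *)
  have -> : arel pi j0 q0 * (unit_norm rho * V beta)
      = - arel (unit_part pi Q) j0 q0 * (unit_norm rho * X beta).
    have -> : X beta = - (highprod pi Q j0 (n - rho) * V beta).
      by apply/eqP; rewrite -addr_eq0 XV.
    by rewrite (arel_split pi Q j0_gt0 q0_gt0) /highprod Eq0 /arel; ring.
  exact/gen_modM/XK.
have nr_gt0 : (0 < n - rho)%N by rewrite Eq0 muln_gt0 j0_gt0.
have nrB : (n - rho <= B)%N by apply: leq_trans (leq_subr _ _) nB.
(* As [e] divides [j0 * N], the degree [rho + e] is within the bound; as [e] divides [n - rho],
   shifting from there to [n] introduces no chain factor on the generators of degree above [rho]. *)
have [e [e_high en eN hpe]] : exists e, [/\ e = j0 \/ high Q d e, (e %| n - rho)%N,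
    (e %| j0 * N)%N & highprod pi Q j0 e = highprod pi Q j0 (n - rho)
      \/ highprod pi Q j0 e = highprod pi Q j0 (j0 * N)].
  apply: (pivot pi chain j0_gt0 j0_le low_dvd); rewrite ?nr_gt0 ?j0N0 ?dvdn_mulr //.
  by rewrite Eq0 dvdn_mulr.
have [gamma Eg] : exists gamma : nat -> k, t * (highprod pi Q j0 e * V beta) = X gamma.
  case: hpe => ->; last by exists gamma0.
  exists (fun i => - t * beta i); rewrite /X.
  under eq_bigr do rewrite -mulrA; rewrite -mulr_sumr -/(X beta).
  have -> : X beta = - (highprod pi Q j0 (n - rho) * V beta).
    by apply/eqP; rewrite -addr_eq0 XV.
  by rewrite mulrNN.
(* Take [m = rho + e] when [e] is high. When [e = j0], the high product is 1 and the base degree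
   serves. *)
have [m [dm mn mbound] [lowm highm shiftm]] : exists2 m,
    [/\ (d <= m)%N, (m <= n)%N & (m <= bound)%N]
  & [/\ forall i, (a i <= rho)%N -> Cc m (a i) = low pi Q d n (a i),
       forall i, (rho < a i)%N -> Cc m (a i) = low pi Q d n (a i) * highprod pi Q j0 e
     & forall i, (rho < a i)%N -> Cc (n - a i) (m - a i) = 1].
  case: e_high => [-> | he].
    exists m0; first by split=> //; apply: leq_addr.
    split=> // i ai.
      by rewrite highprod_j0 // mulr1.
    apply: (chain_coef_base_shift pi j0_gt0 j0_le low_dvd high_dvd) => // j hj jn.
    case: (ltnP (n %% j)%N d) => [lt_d|]; last by left.
    by right; rewrite (residue_mod chain nB hj1 j1n En rho_d hj jn lt_d).
  have de := high_lt he.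
  have e_le : (rho + e <= n)%N by rewrite -leq_subRL // dvdn_leq.
  have eB : (rho + e <= B)%N by apply: leq_trans nB.
  have Ee : ((rho + e) %% e)%N = rho.
    by rewrite modnDr modn_small //; apply: ltn_trans de.
  have e_rho : (e <= rho + e)%N by apply: leq_addl.
  have rho_e : (n = rho + e %[mod j0])%N.
    by rewrite rho_mod (residue_j0 high_dvd eB he e_rho Ee).
  exists (rho + e)%N; split=> //.
  - by apply: leq_trans e_rho; apply: ltnW.
  - apply: leq_trans bound_ge; apply: leq_add; first exact: ltnW.
    by apply: leq_trans (dvdn_leq j0N0 eN) _; rewrite leq_mul2r j0_le orbT.
  - move=> i ai; rewrite (low_mod _ low_dvd _ rho_mod).
    exact: (chain_coef_residue_low pi chain low_dvd high_dvd eB he e_rho Ee).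
  - move=> i ai; rewrite (low_mod _ low_dvd _ rho_e).
    rewrite (chain_coef_residue_high pi chain j0_gt0 j0_le low_dvd eB he e_rho Ee) //.
    by rewrite addKn.
  - move=> i ai.
    exact: (chain_coef_pivot_shift pi chain low_dvd high_dvd nB hj1 j1n).
(* A relation in degree [m] that agrees with [t * beta] on the generators of degree above [rho]. *)
pose beta' i := if (a i <= rho)%N then - gamma i else t * beta i.
have rb' : chain_rel m beta'.
  rewrite /chain_rel (splitE m (highprod pi Q j0 e)) //.
  have -> : X beta' = - X gamma.
    by rewrite /X -sumrN; apply: eq_bigr => i ai; rewrite /beta' ai mulNr.
  have -> : V beta' = t * V beta.
    rewrite /V mulr_sumr; apply: eq_bigr => i ai.
    by rewrite /beta' (negPf ai) mulrA.
  by rewrite -Eg; ring.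
pose beta1 i := if (a i <= m)%N then beta' i * Cc (n - a i) (m - a i) else 0.
have loc1 : locally n beta1 := locally_shift rb' mbound mn nB.
(* The difference is supported on generators of degree at most [rho], where coefficients in degrees
   [n] and [rho] agree, so it comes from degree [rho]. *)
pose beta2 i := t * beta i - beta1 i.
have rel2 : chain_rel n beta2 := chain_relB t rb (chain_rel_shift rb' mn).
have beta2_0 i : (rho < a i)%N -> beta2 i = 0.
  move=> ai; rewrite /beta2 /beta1 (leq_trans (deg_le i) dm) shiftm // mulr1.
  by rewrite /beta' leqNgt ai subrr.
have relrho : chain_rel rho beta2.
  rewrite /chain_rel; have := rel2; rewrite /chain_rel (splitE n _ _ dn lowE highE).
  rewrite [V beta2]big1 ?mulr0 ?addr0 => [|i]; last first.
    by rewrite -ltnNge => ai; rewrite beta2_0 ?mul0r.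
  rewrite /X big_mkcond => XE; rewrite -[RHS]XE; apply: eq_bigr => i _.
  by case: ifP => // ai; rewrite rhoE.
have rho_bound : (rho <= bound)%N.
  by apply: leq_trans bound_ge; apply: leq_trans (leq_addr _ _); apply: ltnW.
have loc2 : locally n beta2.
  apply: locally_ext (locally_shift relrho rho_bound rho_n nB) => i _ _.
  case: (leqP (a i) rho) => [ai|/beta2_0 -> //].
  rewrite (chain_coef_residue_shift pi chain low_dvd high_dvd nB hj1 j1n En) //.
  by rewrite mulr1.
apply: (locally_unit St); apply: locally_ext (locallyD loc1 loc2) => i _ _.
by rewrite /beta2 addrC subrK.
Qed.

End Localized.
End Relations.

(** * Sufficiency *)

Lemma common_multiple (P : nat -> nat -> Prop) M :
  (forall i N N', P i N -> (N %| N')%N -> (0 < N')%N -> P i N') ->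
  (forall i, (i < M)%N -> exists2 N, (0 < N)%N & P i N) ->
  exists2 N, (0 < N)%N & forall i, (i < M)%N -> P i N.
Proof.
move=> Pmul; elim: M => [|M IH] H; first by exists 1%N.
have [N N0 NP] := IH (fun i lt_i => H i (ltnW lt_i)).
have [N' N'0 N'P] := H M (leqnn _).
exists (N * N')%N => [|i]; first by rewrite muln_gt0 N0.
rewrite ltnS leq_eqVlt => /orP[/eqP -> | /NP PN].
  by apply: Pmul N'P _ _; rewrite ?muln_gt0 ?N0 ?dvdn_mull.
by apply: Pmul PN _ _; rewrite ?muln_gt0 ?N0 ?dvdn_mulr.
Qed.

Lemma deg_bounded (k : comNzRingType) (cs : seq (k * nat)) :
  exists d, forall i, (deg cs i <= d)%N.
Proof.
elim: cs => [|c cs [d dP]]; first by exists 0%N => i; rewrite /deg nth_nil.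
exists (maxn c.2 d) => -[|i]; first exact: leq_maxl.
exact: leq_trans (dP i) (leq_maxr _ _).
Qed.

Section Sufficiency.
Variables (k : comNzRingType) (pi : nat -> k).
Local Notation D := (gdpa pi).
Hypothesis adm : admissible pi.
Hypothesis coh : coherent_ring k.
Hypothesis torsion : forall (t : seq k) j, (0 < j)%N -> exists2 N, (0 < N)%N &
  forall x m, (0 < m)%N -> kgen t (arel pi j m * x) -> kgen t (arel pi j N * x).

Lemma coherent_fg_rel (t : seq k) : fg_rel t.
Proof. by apply: (fg_rel_fp (I := kgen t)) => //; apply: coh; exists t. Qed.

Section Generators.
Variable cs : seq (k * nat).
Local Notation s := (size cs).
Local Notation a := (deg cs).

(** The [t] for which [t * b] is generated form an ideal [U]. Were it proper, [local_chain] and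
    [locally_rel] would produce an element of [S] in [U]. *)
Lemma rel_generated : exists bound, forall n b,
  syz pi cs n b -> generated pi cs bound n b.
Proof.
have [d deg_le] := deg_bounded cs.
pose top := d.*2.+1.
(* One [N] serves all of the finitely many pairs [(j, rho)], since multiples of a valid [N] are
   valid. *)
have [N N_gt0 NP] : exists2 N, (0 < N)%N & forall j, (j < top.+1)%N -> (0 < j)%N ->
    forall rho, (rho < d)%N -> forall x m, (0 < m)%N ->
    kgen (mkseq (weight pi cs rho) s) (arel pi j m * x) ->
    kgen (mkseq (weight pi cs rho) s) (arel pi j N * x).
  have mult j t N N' : (0 < j)%N -> (N %| N')%N -> (0 < N')%N -> 
      forall x, kgen t (arel pi j N * x) -> kgen t (arel pi j N' * x).
    move=> j0 dv N'0 x; have [u ->] := arel_dvd pi j0 N'0 dv.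
    by rewrite -mulrA; apply: gen_modM.
  apply: common_multiple => [j N N' H dv N'0 j0 rho lt_rho x m m0 /(H j0 rho lt_rho x m m0)|j _].
    exact: mult.
  case: (posnP j) => [->|j0]; first by exists 1%N.
  have [N N0 NP] : exists2 N, (0 < N)%N & forall rho, (rho < d)%N ->
      forall x m, (0 < m)%N -> kgen (mkseq (weight pi cs rho) s) (arel pi j m * x) ->
      kgen (mkseq (weight pi cs rho) s) (arel pi j N * x).
    apply: common_multiple => [rho N N' H dv N'0 x m m0 /(H x m m0)|rho _].
      exact: mult.
    exact: torsion.
  by exists N.
exists (d + top * N)%N => n b rb.
case: (leqP n (d + top * N)) => [le_n | lt_n]; first exact: generated_low.
apply: NNPP => ngen; pose U t := generated pi cs (d + top * N) n (fun i => t * b i).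
(* Covers the indices in degree [n] and those in [arel pi j0 N] for every [j0 <= top]. *)
pose B := (n + top * N)%N.
have UD x y : U x -> U y -> U (x + y).
  move=> Ux Uy; apply: generated_ext (generated_lin 1 Ux Uy) => i _ _.
  by rewrite mul1r mulrDl.
have UM x y : U y -> U (x * y).
  by move=> Uy; apply: generated_ext (generatedZ x Uy) => i _ _; rewrite mulrA.
have U1 : ~ U 1.
  by move=> U1; apply: ngen; apply: generated_ext U1 => i _ _; rewrite mul1r.
have [S [Q [[S1 SM] dis SQ chain]]] := local_chain adm B UD UM U1.
have nB : (n <= B)%N by apply: leq_addr.
have [t St gt] : locally pi cs (d + top * N) S Q n
    (fun i => b i * Ccoef (unit_part pi Q) n (a i)).
  apply: (locally_rel S1 SM SQ chain deg_le N_gt0) => //.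
  - by move=> j rho x m /andP[j0 jt] lt_rho; apply: NP.
  - exact: leq_addl.
  - rewrite /chain_rel -[RHS]rb; apply: eq_bigr => i _.
    by rewrite (weight_split _ _ Q); case: ifP => _; rewrite ?mulr0 ?mulrA.
apply: (dis (t * unit_norm pi cs Q n)); first by apply: (SM _ _ St); apply: (unit_norm_unit cs S1 SM SQ nB).
apply: generated_ext gt => i lt_i _.
by rewrite -(cofacE pi Q n lt_i); ring.
Qed.

Lemma lin_embed n b : syz pi cs n b -> lin (dmons pi cs) (embed pi cs n b) = 0.
Proof.
move=> rb; apply: dcoefP => m; rewrite dcoef_lin dcoef0.
case: (eqVneq m n) => [->|ne].
  rewrite -[RHS]rb; apply: eq_bigr => i _; rewrite /weight /embed.
  case: ifP => [->|_]; last by rewrite mulr0.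
  by rewrite dcoef_mon eqxx mulr1n; ring.
apply: big1 => i _; case: leqP => // am; rewrite /embed; case: leqP => an.
  by rewrite dcoef_mon -(eqn_add2r (a i)) !subnK // (negPf ne) !mul0r.
by rewrite dcoef0 !mul0r.
Qed.

Lemma embed_rspan (rs : seq (nat -> k)) n b :
  rspan s (fun r => List.In r rs) b ->
  rspan s (fun g => List.In g (map (embed pi cs n) rs)) (embed pi cs n b).
Proof.
elim=> {b} [r rP||x f g _ IHf _ IHg|f g E _ IH].
- exact/rspan_gen/List.in_map.
- by apply: rspan_ext (rspan0 _ _) => i _; rewrite /embed dmon0; case: ifP.
- by apply: rspan_ext (rspan_lin (dmon pi x 0) IHf IHg) => i _; rewrite embed_lin.
- by apply: rspan_ext IH => i lt_i; rewrite /embed E.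
Qed.

(** Coherence of [k] gives finitely many generators in each of the finitely many degrees. *)
Lemma low_rel_fg bound : exists L : seq (nat -> D),
  (forall g, List.In g L -> lin (dmons pi cs) g = 0) /\
  (forall g, low_rel cs bound g -> rspan s (fun g => List.In g L) g).
Proof.
suff [L [L0 LP]] : exists L : seq (nat -> D),
    (forall g, List.In g L -> lin (dmons pi cs) g = 0) /\
    (forall m b, (m < bound.+1)%N -> syz pi cs m b ->
      rspan s (fun g => List.In g L) (embed pi cs m b)).
  by exists L; split=> // g [m [b [mb rb ->]]]; apply: LP.
elim: bound.+1 => [|M [L [L0 LP]]]; first by exists [::].
have [rs [rs0 rsP]] := coherent_fg_rel (mkseq (weight pi cs M) s).
have linE b : lin (mkseq (weight pi cs M) s) b = \sum_(i < s) b i * weight pi cs M i.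
  by rewrite /lin size_mkseq; apply: eq_bigr => i _; rewrite nth_mkseq.
exists (L ++ map (embed pi cs M) rs); split.
  move=> g /(@List.in_app_or _ _ _ _)[/L0 //|/(@List.in_map_iff _ _ _ _ _)[r [<- rP]]].
  by apply: lin_embed; rewrite /syz -linE rs0.
move=> m b; rewrite ltnS leq_eqVlt => /orP[/eqP ->|lt_m] rb.
  have := rsP b; rewrite linE size_mkseq => /(_ rb)/(embed_rspan M).
  by apply: rspan_sub => g gP; apply/rspan_gen/(@List.in_or_app _ _ _ _); right.
apply: rspan_sub (LP m b lt_m rb) => g gP.
by apply/rspan_gen/(@List.in_or_app _ _ _ _); left.
Qed.

(** A relation is the sum of its homogeneous components, and each of these is a relation over [k] in
    its degree. *)
Lemma fg_rel_dmons : fg_rel (dmons pi cs).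
Proof.
have [bound boundP] := rel_generated.
have [L [L0 LP]] := low_rel_fg bound.
exists L; split=> // f f0; rewrite size_dmons.
have [M MP] : exists M, forall i, (i < s)%N -> (size (f i : {poly k}) + a i <= M)%N.
  exists (\max_(i < s) (size (f i : {poly k}) + a i))%N => i lt_i.
  exact: (leq_bigmax (Ordinal lt_i)).
pose b n i := dcoef (f i) (n - a i).
apply: (@rspan_ext _ _ _ (fun i => \sum_(n < M) embed pi cs n (b n) i)).
  move=> i lt_i; apply: dcoefP => m; rewrite dcoef_sum.
  case: (ltnP (m + a i) M) => [lt_m|le_M]; last first.
    rewrite dcoef_small; last by have := MP i lt_i; lia.
    apply: big1 => n _; rewrite /embed; case: leqP => an; rewrite ?dcoef0 //.
    rewrite dcoef_mon; case: eqP => // E; have := ltn_ord n; lia.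
  rewrite (bigD1 (Ordinal lt_m)) //= /embed leq_addl dcoef_mon addnK eqxx mulr1n.
  rewrite /b addnK big1 ?addr0 // => n; rewrite -val_eqE /= => ne.
  case: leqP => an; rewrite ?dcoef0 // dcoef_mon; case: eqP => // E.
  by case/eqP: ne; rewrite E subnK.
apply: (@rspan_sum _ _ _ _ (fun n => embed pi cs n (b n))) => n _.
apply: rspan_sub LP _; apply: boundP; rewrite /syz.
have := congr1 (fun p => dcoef p n) f0; rewrite dcoef_lin dcoef0 => E; rewrite -[RHS]E.
apply: eq_bigr => i _; rewrite /weight /b; case: ifP => _; last by rewrite mulr0.
by ring.
Qed.

End Generators.

Lemma gen_mem (t : seq D) x : x \in t -> gen_mod *%R (@is_zero D) t x.
Proof. by move/(nth_index 0) => <-; apply: gen_nth. Qed.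

(** A homogeneous ideal contains the homogeneous components of its generators, and these monomials
    generate it. *)
Lemma graded_coherent : D_graded_coherent pi (fun p => p = 0).
Proof.
move=> I homI [s0 Is0].
pose cs := [seq ((p : {poly k})`_n, n) | p <- (s0 : seq {poly k}), n <- iota 0 (size p)].
exists (dmons pi cs); split; last exact/(@fg_relP D)/fg_rel_dmons.
have Is0' (x : D) : I x <-> gen_mod *%R (@is_zero D) (s0 : seq D) x := Is0 x.
move=> x; split.
  move/Is0'; apply: (@gen_mod_sub D s0 (dmons pi cs)) => i lt_i.
  rewrite (dmon_sum (leqnn (size (nth (0 : {poly k}) s0 i)))).
  rewrite big_seq_cond; apply: gen_mod_sum => n /andP[nP _]; apply: gen_mem.
  apply/mapP; exists ((nth (0 : {poly k}) s0 i)`_n, n) => //.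
  by apply/allpairsPdep; exists (nth 0 s0 i), n; split=> //; apply: mem_nth.
move=> gx; apply/Is0'; apply: (@gen_mod_sub D (dmons pi cs) s0 _ x) gx => i.
rewrite size_dmons => lt_i; rewrite nth_dmons // /cst /deg.
have /allpairsPdep[p [n [ps _ ->]]] := mem_nth (0, 0%N) lt_i.
apply/Is0'; apply: (homI p _ n); apply/Is0'; exact: gen_mem.
Qed.

End Sufficiency.

Theorem theorem4p10 (k : comNzRingType) (pi : nat -> k) :
  admissible pi ->
  ((forall h : nat, (1 <= h)%N ->
      D_graded_coherent (htrans pi h) (fun p : {poly k} => p = 0))
   <->
   [/\ coherent_ring k, condA2 pi & condA3 pi]).
Proof.
move=> adm; split=> [coh | [cohk A2 _] h h1].
  split; first exact: base_coherent (coh 1%N isT).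
    move=> A h [t At] h1; have [n [n1 nP]] := torsion_bounded (coh h h1) t.
    exists n; split=> // x [m [m1 /At Am]].
    exact/At/(nP x m).
  move=> h A h1 Afg _; exists 0%N; have [[t At] _] := Afg 0%N.
  exact: (quotient_coherent (coh h h1) At).
apply: graded_coherent => //; first exact: admissible_htrans.
(* Torsion of the [h]-transform relative to [j] is controlled by (A2) for the [h * j]-transform. *)
move=> t j j0; have hj1 : (1 <= h * j)%N by rewrite muln_gt0 h1.
have [|N [N1 NP]] := A2 (kgen t) (h * j)%N _ hj1; first by exists t.
exists N => // x m m1; rewrite !arel_htrans // -!a_fun_htrans // => tx.
by apply: NP; exists m.
Qed.
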